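(* Let $k$ be a field and let $A=k\{x_1,\ldots,x_d\}/I$ be a prime monomial $k$-algebra of quadratic growth, where $I$ is generated by words in $x_1,\ldots,x_d$. Suppose there is a constant $C>0$ such that the number of words in $x_1,\ldots,x_d$ of length at most $n$ with nonzero image in $A$ is at most $Cn^2$ for all $n$ sufficiently large. Then $A$ has at most $2C$ prime ideals $P$ such that $A/P$ has GK dimension one.
   Context: Algebras are associative and unital; $k\{x_1,\ldots,x_d\}$ is the free algebra. A frame of a finitely generated $k$-algebra $A$ is a finite-dimensional $k$-subspace $V$ of $A$ with $1\in V$ that generates $A$ as a $k$-algebra. $A$ has quadratic growth if there exist a frame $V$ of $A$ and constants $C_1,C_2>0$ with $C_1n^2\le \dim_k(V^n)\le C_2n^2$ for all $n\ge 1$. The GK dimension is $\mathrm{GKdim}(A)=\limsup_{n\to\infty}\log(\dim_k V^n)/\log n$ for any frame $V$ of $A$. *)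

(* Defs.v *)
From HB Require Import structures.
From mathcomp Require Import all_boot all_order all_algebra.
From mathcomp Require Import all_classical all_reals all_analysis.
From mathcomp Require Import generic_quotient.
(* The notations of monalg clash with those of MathComp-Analysis. *)
From mathcomp.multinomials Require Import -(notations) monalg.

Set Implicit Arguments.
Unset Strict Implicit.
Unset Printing Implicit Defensive.

Import Order.TTheory GRing.Theory Num.Theory.
Import numFieldNormedType.Exports.

Local Open Scope classical_set_scope.
Local Open Scope ring_scope.
Local Open Scope quotient_scope.

Section Ideals.
Variable A : nzRingType.

Definition two_sided_ideal (I : set A) : Prop :=
  GRing.zmod_closed [in I] /\ forall a b x, I x -> I (a * x * b).

Definition ideal_generated (S : set A) : set A := smallest two_sided_ideal S.

(* The ideal product JK is the additive span of the products xy, so it lies in P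
   exactly when all of these do. *)
Definition prime_ideal (P : set A) : Prop :=
  [/\ two_sided_ideal P, ~ P 1 &
      forall J K : set A, two_sided_ideal J -> two_sided_ideal K ->
        (forall x y, J x -> K y -> P (x * y)) -> J `<=` P \/ K `<=` P].

Definition prime_ring : Prop := prime_ideal [set 0].

(* Only proper ideals are bundled, because [algType] excludes the zero ring. *)
Record properIdeal := ProperIdeal {
  ideal_set :> set A;
  ideal_setP : two_sided_ideal ideal_set;
  ideal_set1 : ~ ideal_set 1
}.

Definition ideal_pred (I : properIdeal) : {pred A} := [in (I : set A)].

Lemma ideal_pred_zmod I : GRing.zmod_closed (ideal_pred I).
Proof. by case: (ideal_setP I). Qed.

HB.instance Definition _ I :=
  GRing.isZmodClosed.Build A (ideal_pred I) (ideal_pred_zmod I).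

End Ideals.

(* MathComp only equips [Quotient.quot] with a ring structure over commutative
   rings; here the quotient of a k-algebra by a two-sided ideal is made a
   k-algebra, on top of the library's quotient module. *)
Definition quot_alg (k : fieldType) (A : algType k) (I : properIdeal A) : Type :=
  Quotient.quot (ideal_pred I).

Section QuotAlg.
Variables (k : fieldType) (A : algType k) (I : properIdeal A).
Local Notation Q := (quot_alg I).

HB.instance Definition _ := GRing.Zmodule.copy Q (Quotient.quot (ideal_pred I)).

Definition quot_pi (x : A) : Q := \pi_(Quotient.quot (ideal_pred I)) x.

Definition quot_repr (q : Q) : A := repr (q : Quotient.quot (ideal_pred I)).

Lemma quot_reprK : cancel quot_repr quot_pi.
Proof. by move=> q; apply: reprK. Qed.

Lemma quot_piE x y : quot_pi x = quot_pi y <-> ideal_set I (x - y).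
Proof.
have := Quotient.idealrBE (ideal_pred I) x y; rewrite /quot_pi => e.
split=> [/eqP|Ixy]; first by rewrite -e => /set_mem.
by apply/eqP; rewrite -e; apply/mem_set.
Qed.

Lemma quot_pi0 : quot_pi 0 = 0.
Proof. exact: (raddf0 \pi_(Quotient.quot (ideal_pred I))). Qed.

Lemma quot_piD : {morph quot_pi : x y / x + y}.
Proof. exact: (raddfD \pi_(Quotient.quot (ideal_pred I))). Qed.

Definition quot_one : Q := quot_pi 1.
Definition quot_mul (p q : Q) : Q := quot_pi (quot_repr p * quot_repr q).
Definition quot_scale (c : k) (q : Q) : Q := quot_pi (c *: quot_repr q).

Lemma quot_rel x : ideal_set I (quot_repr (quot_pi x) - x).
Proof. by apply/quot_piE; rewrite quot_reprK. Qed.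

Lemma ideal_set_mul a b x : ideal_set I x -> ideal_set I (a * x * b).
Proof. by case: (ideal_setP I) => _; apply. Qed.

Lemma ideal_set_add x y : ideal_set I x -> ideal_set I y -> ideal_set I (x + y).
Proof.
move=> /mem_set Ix /mem_set Iy; apply/set_mem.
exact: (@rpredD _ (ideal_pred I)).
Qed.

Lemma quot_piM : {morph quot_pi : x y / x * y >-> quot_mul x y}.
Proof.
move=> x y; apply/esym/quot_piE.
set x' := quot_repr _; set y' := quot_repr _.
have -> : x' * y' - x * y = 1 * (x' - x) * y' + x * (y' - y) * 1.
  by rewrite mul1r mulr1 mulrBl mulrBr addrA subrK.
by apply: ideal_set_add; apply: ideal_set_mul; apply: quot_rel.
Qed.

Lemma quot_piZ c x : quot_pi (c *: x) = quot_scale c (quot_pi x).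
Proof.
apply/esym/quot_piE; rewrite -scalerBr.
set z := _ - _.
have -> : c *: z = c%:A * z * 1 by rewrite -scalerAl mul1r mulr1.
by apply: ideal_set_mul; apply: quot_rel.
Qed.

Lemma quot_mulA : associative quot_mul.
Proof.
move=> x y z; rewrite -[x]quot_reprK -[y]quot_reprK -[z]quot_reprK.
by rewrite -!quot_piM mulrA.
Qed.

Lemma quot_mul1 : left_id quot_one quot_mul.
Proof. by move=> x; rewrite -[x]quot_reprK -quot_piM mul1r. Qed.

Lemma quot_mulr1 : right_id quot_one quot_mul.
Proof. by move=> x; rewrite -[x]quot_reprK -quot_piM mulr1. Qed.

Lemma quot_mulDl : left_distributive quot_mul +%R.
Proof.
move=> x y z; rewrite -[x]quot_reprK -[y]quot_reprK -[z]quot_reprK.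
by rewrite -!(quot_piM, quot_piD) mulrDl.
Qed.

Lemma quot_mulDr : right_distributive quot_mul +%R.
Proof.
move=> x y z; rewrite -[x]quot_reprK -[y]quot_reprK -[z]quot_reprK.
by rewrite -!(quot_piM, quot_piD) mulrDr.
Qed.

Lemma quot_one_neq0 : quot_one != 0.
Proof.
apply/eqP; rewrite -quot_pi0 => /quot_piE; rewrite subr0; exact: ideal_set1.
Qed.

HB.instance Definition _ := GRing.Zmodule_isNzRing.Build Q
  quot_mulA quot_mul1 quot_mulr1 quot_mulDl quot_mulDr quot_one_neq0.

Lemma quot_scaleA a b x : quot_scale a (quot_scale b x) = quot_scale (a * b) x.
Proof. by rewrite -[x]quot_reprK -!quot_piZ scalerA. Qed.

Lemma quot_scale1 : left_id 1 quot_scale.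
Proof. by move=> x; rewrite -[x]quot_reprK -quot_piZ scale1r. Qed.

Lemma quot_scaleDr : right_distributive quot_scale +%R.
Proof.
move=> c x y; rewrite -[x]quot_reprK -[y]quot_reprK.
by rewrite -!(quot_piZ, quot_piD) scalerDr.
Qed.

Lemma quot_scaleDl x : {morph quot_scale^~ x : a b / a + b}.
Proof.
by move=> a b; rewrite -[x]quot_reprK -!(quot_piZ, quot_piD) scalerDl.
Qed.

HB.instance Definition _ := GRing.Zmodule_isLmodule.Build k Q
  quot_scaleA quot_scale1 quot_scaleDr quot_scaleDl.

Lemma quot_scaleAl c (x y : Q) : c *: (x * y) = (c *: x) * y.
Proof.
rewrite -[x]quot_reprK -[y]quot_reprK.
by rewrite /GRing.scale /GRing.mul /= -!(quot_piZ, quot_piM) scalerAl.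
Qed.

HB.instance Definition _ := GRing.Lmodule_isLalgebra.Build k Q quot_scaleAl.

Lemma quot_scaleAr c (x y : Q) : c *: (x * y) = x * (c *: y).
Proof.
rewrite -[x]quot_reprK -[y]quot_reprK.
by rewrite /GRing.scale /GRing.mul /= -!(quot_piZ, quot_piM) scalerAr.
Qed.

HB.instance Definition _ := GRing.Lalgebra_isAlgebra.Build k Q quot_scaleAr.

End QuotAlg.

(* The algebra of the free monoid on d letters. *)
Definition free_alg (k : fieldType) (d : nat) : Type := malg (fmonom 'I_d) k.

Section FreeAlg.
Variables (k : fieldType) (d : nat).

HB.instance Definition _ :=
  GRing.Lalgebra.copy (free_alg k d) (malg (fmonom 'I_d) k).

Lemma free_alg_scaleAr c (x y : free_alg k d) : c *: (x * y) = x * (c *: y).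
Proof.
apply/(@malgP _ k) => m; rewrite mcoeffZ mcoeffMl.
rewrite (mcoeffMlw m (finmap.fsubset_refl (msupp x)) (msuppZ_le c y)).
rewrite mulr_sumr; apply: eq_bigr => k1 _.
rewrite mulr_sumr; apply: eq_bigr => k2 _.
by rewrite mcoeffZ mulrnAr mulrCA.
Qed.

HB.instance Definition _ :=
  GRing.Lalgebra_isAlgebra.Build k (free_alg k d) free_alg_scaleAr.

Definition letter (i : 'I_d) : free_alg k d := mkmalgU (fmu i) 1.

Definition word (w : seq 'I_d) : free_alg k d := \prod_(i <- w) letter i.

End FreeAlg.

Section Growth.
Variables (R : realType) (k : fieldType) (A : algType k).

Definition lin_span (S : set A) : set A :=
  smallest (fun U : set A => GRing.submod_closed [in U]) S.

Definition alg_span (S : set A) : set A :=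
  smallest (fun B : set A => GRing.subalg_closed [in B]) S.

Definition is_basis (n : nat) (b : 'I_n -> A) (V : set A) : Prop :=
  (forall c : 'I_n -> k, \sum_(i < n) c i *: b i = 0 -> forall i, c i = 0) /\
  lin_span (range b) = V.

Definition finite_dim (V : set A) : Prop :=
  exists n (b : 'I_n -> A), is_basis b V.

(* The default value 0 is only used when V is not a finite-dimensional
   subspace. *)
Definition dimk (V : set A) : nat :=
  xget 0%N [set n | exists b : 'I_n -> A, is_basis b V].

Definition pow_space (V : set A) (n : nat) : set A :=
  lin_span [set \prod_(i < n) v i | v in [set v : 'I_n -> A | forall i, V (v i)]].

Definition frame (V : set A) : Prop :=
  [/\ finite_dim V, V 1 & alg_span V = setT].

Definition quadratic_growth : Prop :=
  exists2 V : set A, frame V &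
    exists C1 C2 : R, [/\ 0 < C1, 0 < C2 & forall n : nat, (1 <= n)%N ->
      C1 * n%:R ^+ 2 <= (dimk (pow_space V n))%:R <= C2 * n%:R ^+ 2].

Definition growth_degree (V : set A) : \bar R :=
  limn_esup (fun n : nat => (ln (dimk (pow_space V n))%:R / ln n%:R)%:E).

(* [growth_degree R V] is the same for all frames V of A. *)
Definition has_GKdim (g : \bar R) : Prop :=
  exists2 V : set A, frame V & growth_degree V = g.

End Growth.

(* Main.v *)
Require Import Defs.
From mathcomp Require Import all_boot all_order all_algebra.
From mathcomp Require Import all_classical all_reals all_analysis.
From mathcomp Require Import zify lra.
From mathcomp.multinomials Require Import -(notations) monalg.

(** Let [L] be the set of words that are nonzero in the prime algebra [A], and
for a prime [P] let [L_P], contained in [L], be the set of words whose image lies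
outside [P].

If [A/P] has GK dimension one then [L_P] is the set of factors of a periodic
sequence.  First, the words that are not combinations of smaller words in the
degree-lexicographic order form a factor-closed language that measures the
growth of [A/P]; as this growth is subquadratic, Bergman's gap argument
[bergman_gap] makes it linear ([linear_growth]).  Then the right ideals [w(A/P)]
have a rank, the slope of their growth; a nonzero principal right ideal has rank
at least one, so for a nonzero word [w] of minimal rank every left
multiplication by [wu] with [wuw] nonzero is injective on [w(A/P)]
([minimal_rank]).  Hence such words [wu] are closed under products.  Two of them
that do not commute would give exponentially many words in [L], so they all
commute with a fixed one, [v], and every word of [L_P] is a factor of a power of
[v] ([nonzero_words_periodic]).

The prime is determined by [L_P]: a linear relation between nonzero words of
[A/P] would, after multiplication by a long prefix, express one long factor of the
periodic sequence by shorter words, and make [A/P] finite-dimensional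
([periodic_indep], [GK1_inj]).

It remains to bound the number [m] of distinct periodic languages inside [L].
Since [A] has quadratic growth, [L] is not one of them; since [A] is prime, any
factor of a periodic sequence extends inside [L] to a word that leaves it.  For
each sequence and each large [s < n] this gives a word of [L] of length [n] that
follows the sequence for exactly [s] letters, and all these words are distinct
because two different periodic languages share no long word ([exit_count]).  So
[L] has at least [m (n - N)] words of length [n], hence about [m n^2 / 2] words of
length at most [n], and [m <= 2 C]. *)

Set Implicit Arguments.
Unset Strict Implicit.
Unset Printing Implicit Defensive.

Import Order.TTheory GRing.Theory Num.Theory.
Import numFieldNormedType.Exports.

Local Open Scope classical_set_scope.
Local Open Scope card_scope.
Local Open Scope ring_scope.

(** * Linear algebra without a global dimension *)

Section Span.
Variables (k : fieldType) (A : algType k).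
Implicit Types (S U : set A).

(** The closure conditions of [submod_closed] for sets, free of boolean
membership. *)
Definition vsubspace U := U 0 /\ forall a u v, U u -> U v -> U (a *: u + v).

Lemma submodP U : GRing.submod_closed [in U] <-> vsubspace U.
Proof.
split=> -[U0 UD]; split.
- exact: set_mem.
- by move=> a u v /mem_set Uu /mem_set Uv; apply/set_mem/UD.
- exact: mem_set.
- by move=> a u v /set_mem Uu /set_mem Uv; apply/mem_set/UD.
Qed.

Lemma lin_span_subspace S : vsubspace (lin_span S).
Proof.
split=> [T [/submodP[T0 _] _] //|a u v Su Sv T TS].
have /submodP[_ TD] := TS.1.
by apply: TD; [apply: Su|apply: Sv].
Qed.

Lemma lin_span_min S U : vsubspace U -> S `<=` U -> lin_span S `<=` U.
Proof. by move=> /submodP sU SU; apply: smallest_sub. Qed.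

Lemma sub_lin_span S : S `<=` lin_span S.
Proof. exact: sub_smallest. Qed.

Lemma lin_span_le S S' : S `<=` lin_span S' -> lin_span S `<=` lin_span S'.
Proof. by apply: lin_span_min; apply: lin_span_subspace. Qed.

Lemma lin_span_mono S S' : S `<=` S' -> lin_span S `<=` lin_span S'.
Proof. by move=> h; apply: lin_span_le => x /h; apply: sub_lin_span. Qed.

Lemma subspaceZ U a u : vsubspace U -> U u -> U (a *: u).
Proof. by case=> U0 UD Uu; rewrite -[_ *: _]addr0; apply: UD. Qed.

Lemma subspaceD U u v : vsubspace U -> U u -> U v -> U (u + v).
Proof. by case=> U0 UD Uu Uv; rewrite -[u]scale1r; apply: UD. Qed.

Lemma subspaceN U u : vsubspace U -> U u -> U (- u).
Proof. by move=> sU Uu; rewrite -scaleN1r; apply: subspaceZ. Qed.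

Lemma subspace_sum U (T : Type) (r : seq T) (Q : pred T) (F : T -> A) :
  vsubspace U -> (forall i, Q i -> U (F i)) -> U (\sum_(i <- r | Q i) F i).
Proof.
move=> sU UF; elim/big_ind: _ => //; first by case: sU.
by move=> x y; apply: subspaceD.
Qed.

Lemma lin_spanM S S' S'' :
  (forall x y, S x -> S' y -> lin_span S'' (x * y)) ->
  forall x y, lin_span S x -> lin_span S' y -> lin_span S'' (x * y).
Proof.
have [s0 sD] := lin_span_subspace S''.
move=> h x y Sx; move: x Sx y.
apply: (lin_span_min (U := [set x | forall y, lin_span S' y -> lin_span S'' (x * y)])).
  split=> [y _|a u v hu hv y Sy] /=; first by rewrite mul0r.
  by rewrite mulrDl -scalerAl; apply: sD; [exact: (hu _ Sy)|exact: (hv _ Sy)].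
move=> x Sx /=; apply: (@lin_span_min S' [set y | lin_span S'' (x * y)]).
  split=> [|a u v hu hv] /=; first by rewrite mulr0.
  by rewrite mulrDr -scalerAr; apply: sD.
by move=> y Sy /=; apply: h.
Qed.

Lemma lin_span_rangeP (T : finType) (b : T -> A) x :
  lin_span (range b) x <-> exists c : T -> k, x = \sum_t c t *: b t.
Proof.
split=> [|[c ->]]; last first.
  apply: subspace_sum; first exact: lin_span_subspace.
  move=> t _; apply: (subspaceZ _ (lin_span_subspace _)).
  by apply: sub_lin_span; exists t.
move: x; apply: lin_span_min.
  split=> [|a u v [c ->] [c' ->]].
    by exists (fun=> 0); rewrite big1 // => t _; rewrite scale0r.
  exists (fun t => a * c t + c' t); rewrite scaler_sumr -big_split /=.
  by apply: eq_bigr => t _; rewrite scalerDl scalerA.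
move=> _ [t _ <-]; exists (fun s => (s == t)%:R).
rewrite (bigD1 t) //= eqxx scale1r big1 ?addr0 // => s /negPf ->.
by rewrite scale0r.
Qed.

Definition indep (T : finType) (b : T -> A) :=
  forall c : T -> k, \sum_t c t *: b t = 0 -> forall t, c t = 0.

(** Dimension at most [N], stated through independent families so that it
applies to infinite-dimensional subspaces as well. *)
Definition dim_le U N :=
  forall (T : finType) (b : T -> A), (forall t, U (b t)) -> indep b -> (#|T| <= N)%N.

Lemma dim_leS U U' N N' : U' `<=` U -> (N <= N')%N -> dim_le U N -> dim_le U' N'.
Proof. by move=> UU NN h T b Ub ib; apply: leq_trans NN; apply: (h T b) => // t; apply: UU. Qed.

Lemma indep_reindex (T T' : finType) (h : T' -> T) (b : T -> A) :
  bijective h -> indep b -> indep (b \o h).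
Proof.
move=> [g gK hK] ib c c0 t'.
have := ib (c \o g); rewrite (reindex h) /=; last by exists g => x _; [rewrite gK|rewrite hK].
under eq_bigr do rewrite gK.
by move=> /(_ c0 (h t')); rewrite gK.
Qed.

(** A matrix with more rows than columns has a nontrivial left kernel. *)
Lemma tall_relation (T J : finType) (f : T -> J -> k) : (#|J| < #|T|)%N ->
  exists2 c : T -> k, (exists t, c t != 0) & forall j, \sum_t c t * f t j = 0.
Proof.
move=> JT; pose M := \matrix_(i < #|T|, j < #|J|) f (enum_val i) (enum_val j).
have : kermx M != 0.
  rewrite -mxrank_eq0 mxrank_ker subn_eq0 -ltnNge.
  exact: leq_ltn_trans (rank_leq_col _) JT.
move=> /rowV0Pn[u /sub_kermxP uM] u0; exists (fun t => u 0 (enum_rank t)).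
  apply: contrapT => h; move/eqP: u0; apply; apply/rowP => i; rewrite mxE.
  apply/eqP/negPn/negP => ui; apply: h; exists (enum_val i); by rewrite enum_valK.
move=> j; have /rowP/(_ (enum_rank j)) := uM; rewrite !mxE => E.
rewrite -[RHS]E (reindex (enum_val : 'I_#|T| -> T)) /=.
  by apply: eq_bigr => i _; rewrite enum_valK mxE enum_rankK.
by exists enum_rank => i _; rewrite ?enum_valK ?enum_rankK.
Qed.

Lemma dim_le_span (T : finType) (s : T -> A) U :
  U `<=` lin_span (range s) -> dim_le U #|T|.
Proof.
move=> Us T' b Ub ib; rewrite leqNgt; apply/negP => TT'.
have /choice[f fE] : forall i, exists c : T -> k, b i = \sum_j c j *: s j.
  by move=> i; apply/lin_span_rangeP; apply: Us; apply: Ub.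
have [c [t ct] c0] := tall_relation f TT'.
move/eqP: ct; apply; apply: ib.
transitivity (\sum_i \sum_j (c i * f i j) *: s j).
  by apply: eq_bigr => i _; rewrite fE scaler_sumr; apply: eq_bigr => j _; rewrite scalerA.
rewrite exchange_big big1 // => j _ /=.
by rewrite -scaler_suml c0 scale0r.
Qed.

Lemma indep_extend (T : finType) (b : T -> A) x :
  indep b -> ~ lin_span (range b) x -> indep (fun o : option T => oapp b x o).
Proof.
move=> ib xb c; rewrite (bigD1 None) //= (reindex_omap Some id) /=; last by case.
under eq_bigl do rewrite eqxx.
have [c0|c0 E] := eqVneq (c None) 0.
  by rewrite c0 scale0r add0r => /(ib (c \o Some)) h [t|//]; apply: h.
exfalso; apply: xb; apply/lin_span_rangeP.
exists (fun t => - (c None)^-1 * c (Some t)).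
have -> : x = (c None)^-1 *: (c None *: x) by rewrite scalerA mulVf // scale1r.
move/eqP: E; rewrite addr_eq0 => /eqP ->.
rewrite scalerN scaler_sumr -sumrN; apply: eq_bigr => t _.
by rewrite scalerA mulNr scaleNr.
Qed.

Lemma indep_ord (T : finType) (b : T -> A) :
  indep b -> exists2 b' : 'I_#|T| -> A, indep b' & range b' = range b.
Proof.
move=> ib; exists (b \o enum_val).
  by apply: indep_reindex => //; apply: enum_val_bij.
apply/seteqP; split=> _ [t _ <-]; first by exists (enum_val t).
by exists (enum_rank t) => //=; rewrite enum_rankK.
Qed.

Lemma dim_le_basis U N : vsubspace U -> dim_le U N ->
  exists n (b : 'I_n -> A), is_basis b U.
Proof.
move=> sU UN.
pose Q n := `[< exists b : 'I_n -> A, indep b /\ forall i, U (b i) >].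
have Q0 : exists n, Q n.
  exists 0%N; apply/asboolP; have f0 : 'I_0 -> A by case.
  by exists f0; split=> [c _|] [].
have QN n : Q n -> (n <= N)%N.
  by case/asboolP=> b [ib Ub]; rewrite -(card_ord n); apply: (UN _ b).
case: (ex_maxnP Q0 QN) => n /asboolP[b [ib Ub]] nmax.
exists n, b; split=> //; apply/seteqP; split.
  by apply: lin_span_min => // _ [i _ <-].
move=> x Ux; apply: contrapT => bx.
have [b' ib' rb'] := indep_ord (indep_extend ib bx).
have : (#|{: option 'I_n}| <= n)%N.
  apply: nmax; apply/asboolP; exists b'; split=> // i.
  have : range b' (b' i) by exists i.
  by rewrite rb' => -[[j|] _ <-] //=.
by rewrite card_option card_ord ltnn.
Qed.

Lemma dimk_le U N : dim_le U N -> (dimk U <= N)%N.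
Proof.
rewrite /dimk => UN; case: xgetP => [n _ [b [ib bU]]|_] //.
rewrite -(card_ord n); apply: (UN _ b) => // i.
by rewrite -bU; apply: sub_lin_span; exists i.
Qed.

Lemma dim_le_dimk U N : vsubspace U -> dim_le U N -> dim_le U (dimk U).
Proof.
move=> sU UN; have [n0 hn0] := dim_le_basis sU UN.
rewrite /dimk; case: xgetP => [n _ [b [ib bU]]|/(_ n0)//].
by rewrite -(card_ord n); apply: (@dim_le_span _ b); rewrite bU.
Qed.

(** Rank-nullity for left multiplication by [z]: lifting an independent family
of the image and adding one of the kernel gives an independent family. *)
Lemma dim_le_ker U N z (T : finType) (f : T -> A) :
  dim_le U N -> (forall t, U (f t)) -> (forall t, z * f t = 0) -> indep f ->
  dim_le [set z * u | u in U] (N - #|T|) /\ (#|T| <= N)%N.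
Proof.
move=> UN Uf zf fi; split; last exact: (UN _ f).
move=> T' g Ug gi; rewrite leq_subRL; last exact: (UN _ f).
have /choice[g' gE] : forall t, exists u, U u /\ z * u = g t.
  by move=> t; have [u] := Ug t; exists u.
rewrite -card_sum; apply: (UN _ (fun s => match s with inl t => f t | inr t => g' t end)).
  by case=> t //; case: (gE t).
move=> c; rewrite big_sumType /= => E.
have c2 t : c (inr t) = 0.
  apply: (gi (c \o inr)) => /=.
  have /(congr1 ( *%R z)) := E; rewrite mulrDr mulr0 !mulr_sumr.
  rewrite big1 ?add0r => [E'|t' _]; last by rewrite -scalerAr zf scaler0.
  by rewrite -[RHS]E'; apply: eq_bigr => t' _; rewrite -scalerAr (gE t').2.
case=> t //; apply: (fi (c \o inl)) => /=.
by move: E; rewrite [X in _ + X]big1 ?addr0 // => t' _; rewrite c2 scale0r.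
Qed.

(** In a relation, the last element with a nonzero coefficient would lie in an
earlier term of the chain. *)
Lemma indep_chain (V : nat -> set A) (z : nat -> A) n :
  (forall i, vsubspace (V i)) -> (forall i j, (i <= j)%N -> V i `<=` V j) ->
  z 0%N != 0 -> (forall i, V i (z i)) -> (forall i, ~ V i (z i.+1)) ->
  indep (fun i : 'I_n => z i).
Proof.
move=> sV Vmono z0 Vz NVz; elim: n => [|n IH] c; first by move=> _ [].
rewrite big_ord_recr /= => E.
have cn : c ord_max = 0.
  apply/eqP/negPn/negP => cn.
  have zE : z n = \sum_(i < n) (- (c ord_max)^-1 * c (widen_ord (leqnSn n) i)) *: z i.
    have -> : z n = (c ord_max)^-1 *: (c ord_max *: z n) by rewrite scalerA mulVf // scale1r.
    move/eqP: E; rewrite addrC addr_eq0 => /eqP ->.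
    rewrite scalerN scaler_sumr -sumrN; apply: eq_bigr => t _.
    by rewrite scalerA mulNr scaleNr.
  case: n {IH} c E cn zE => [|n] c E cn zE.
    by move: z0; rewrite zE big_ord0 eqxx.
  apply: (NVz n); rewrite zE; apply: subspace_sum => // i _.
  by apply: subspaceZ => //; apply: (@Vmono i n) => //; rewrite -ltnS.
move: E; rewrite cn scale0r addr0 => /(IH (fun i => c (widen_ord (leqnSn n) i))) h i.
case: (unliftP ord_max i) => [j ->|->//].
by rewrite -(h j); congr c; apply: val_inj => /=; rewrite /bump leqNgt ltn_ord.
Qed.

Lemma subspace_mulL U y : vsubspace U -> vsubspace [set y * x | x in U].
Proof.
move=> sU; split; first by exists 0; [case: sU|rewrite mulr0].
move=> a _ _ [u Uu <-] [v Uv <-]; exists (a *: u + v); first by case: sU => _; apply.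
by rewrite mulrDr -scalerAr.
Qed.

End Span.

(** * Languages of slow growth *)

Section Words.
Local Open Scope nat_scope.
Local Open Scope classical_set_scope.
Variable T : finType.
Implicit Types (L : set (seq T)) (u v w : seq T) (c : nat -> T).

Definition factor_closed L := forall a u b, L (a ++ u ++ b) -> L u.

Definition irreducible L := forall u v, L u -> L v -> exists b, L (u ++ b ++ v).

Definition count_len L n := #|[pred t : n.-tuple T | `[< L t >]]|.

Lemma count_len_ge L n (S : finType) (f : S -> seq T) :
  (forall s, L (f s)) -> (forall s, size (f s) = n) -> injective f ->
  #|S| <= count_len L n.
Proof.
move=> Lf sf fi.
pose g s : n.-tuple T := tcast (sf s) (in_tuple (f s)).
have gE s : g s = f s :> seq T by rewrite val_tcast.
rewrite -(@card_imset _ _ g); last by move=> s s' /(congr1 (@tval n T)); rewrite !gE => /fi.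
rewrite /count_len; apply: subset_leq_card; apply/fintype.subsetP => _ /imsetP[s _ ->].
by rewrite inE gE; exact: Lf.
Qed.

Lemma count_len_le L n (S : finType) (f : n.-tuple T -> S) :
  (forall t t' : n.-tuple T, L t -> L t' -> f t = f t' -> t = t') -> count_len L n <= #|S|.
Proof.
move=> fi; rewrite /count_len -(@card_in_imset _ _ f); first exact: max_card.
by move=> t t'; rewrite !inE; apply: fi.
Qed.

Lemma count_len_max L n : count_len L n <= #|T| ^ n.
Proof. by rewrite -card_tuple; apply: (@count_len_le _ _ _ id). Qed.

Lemma factor_take L n w : factor_closed L -> L w -> L (take n w).
Proof. by move=> fL; rewrite -{1}(cat_take_drop n w) => /(fL [::]). Qed.

Lemma factor_drop L n w : factor_closed L -> L w -> L (drop n w).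
Proof. by move=> fL Lw; apply: (fL (take n w) _ [::]); rewrite cats0 cat_take_drop. Qed.

Section Bergman.
Variables (x0 : T) (L : set (seq T)) (e : nat).
Hypothesis fL : factor_closed L.
Hypothesis Le : count_len L e <= e.

Lemma window_collision w (p : nat -> nat) :
  L w -> (forall x, x <= e -> p x + e <= size w) ->
  exists x y, [/\ x < y, y <= e & forall m, m < e -> nth x0 w (p x + m) = nth x0 w (p y + m)].
Proof.
move=> Lw pw.
pose f (x : 'I_e.+1) := take e (drop (p x) w).
have sf x : size (f x) = e.
  by rewrite size_takel // size_drop; have := pw x (ltn_ord x : x <= e); lia.
have Lf x : L (f x) by apply: factor_take => //; apply: factor_drop.
have /injectivePn : ~~ injectiveb f.
  apply/negP => /injectiveP fi; have := count_len_ge Lf sf fi; rewrite card_ord; lia.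
case=> x [y xy fxy].
have E m : m < e -> nth x0 w (p x + m) = nth x0 w (p y + m).
  by move=> me; have := congr1 (nth x0 ^~ m) fxy; rewrite /f !nth_take // !nth_drop.
have := ltn_ord x; have := ltn_ord y.
case: (ltngtP x y) => [lt|lt|/val_inj]; last by move/eqP: xy.
  by exists x, y; split.
by exists y, x; split=> // m me; rewrite E.
Qed.

(** Among the first [e + 1] windows of length [e], two coincide; take such a
pair at minimal distance [q].  This starts a run of period [q], and if the run
stopped more than [e] letters before the end of [w], then [q] windows of the run
together with [e - q + 1] windows reaching beyond its end would be [e + 1]
distinct factors of length [e]. *)
Lemma bergman_structure w : L w -> 2 * e <= size w ->
  exists i q s, [/\ i + q <= e, 0 < q, s <= e &
    forall m, i <= m -> m + q < size w - s -> nth x0 w m = nth x0 w (m + q)].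
Proof.
move=> Lw sw; set n := size w; pose W := nth x0 w.
pose Q q := [exists i : 'I_e.+1, [&& 0 < q, i + q <= e &
  [forall m : 'I_e, W (i + m) == W (i + q + m)]]].
have exQ : exists q, Q q.
  have [|x [y [xy ye E]]] := @window_collision w id Lw; first by move=> x; lia.
  have xe : x < e.+1 by lia.
  exists (y - x); apply/existsP; exists (Ordinal xe) => /=.
  apply/and3P; split; [lia|lia|apply/forallP => m; apply/eqP].
  by rewrite /W E //; congr (nth _ _ _); lia.
case: (ex_minnP exQ) => q /existsP[i /and3P[q0 iq /forallP ieq]] qmin.
have ie m : m < e -> W (i + m) = W (i + q + m).
  by move=> me; apply/eqP; exact: (ieq (Ordinal me)).
have min x y : x < y -> y <= e -> y - x < q -> exists2 m, m < e & W (x + m) <> W (y + m).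
  move=> xy ye yx; apply: contrapT => h.
  have : Q (y - x).
    have xe : x < e.+1 by lia.
    apply/existsP; exists (Ordinal xe) => /=; apply/and3P; split; [lia|lia|].
    apply/forallP => m; have -> : x + (y - x) = y by lia.
    by apply/eqP; apply: contrapT => hm; apply: h; exists m.
  by move/qmin; lia.
pose R b := (b <= n) && [forall m : 'I_n, (i <= m) && (m + q < b) ==> (W m == W (m + q))].
have RP b : R b -> forall m, i <= m -> m + q < b -> W m = W (m + q).
  case/andP=> bn /forallP h m im mb.
  have mn : m < n by lia.
  by have := h (Ordinal mn); rewrite /= im mb /= => /eqP.
have R0 : R (i + q + e).
  apply/andP; split; first by lia.
  apply/forallP => m; apply/implyP => /andP[im mb]; apply/eqP.
  have := ie (m - i); have -> : i + (m - i) = m by lia.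
  have -> : i + q + (m - i) = m + q by lia.
  by apply; lia.
have Rn b : R b -> b <= n by case/andP.
have exR : exists b, R b by exists (i + q + e).
case: (ex_maxnP exR Rn) => b Rb bmax.
have be := bmax _ R0; have bn := Rn _ Rb.
have run := RP _ Rb.
have [snb|snb] := leqP (n - b) e.
  exists i, q, (n - b); split=> // m im mb; apply: run => //.
  by rewrite -/n in mb; lia.
exfalso.
have brk : W (b - q) <> W b.
  move=> h; suff : R b.+1 by move/bmax; lia.
  apply/andP; split; first by lia.
  apply/forallP => m; apply/implyP => /andP[im mb]; apply/eqP.
  have [mb'|mb'] := ltnP (m + q) b; first exact: run.
  have -> : nat_of_ord m = b - q by lia.
  by rewrite h; congr W; lia.
(* the number of occurrences of [y] among the [q] letters from position [p] on;
   it is constant along the run and changes where the run stops *)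
pose ct y p := \sum_(x < q) (W (p + x) == y).
have ctS y p : ct y p.+1 + (W p == y) = ct y p + (W (p + q) == y).
  rewrite /ct; case: (q) q0 => // q' _.
  rewrite big_ord_recr [in RHS]big_ord_recl /= addn0.
  have -> : \sum_(j < q') (W (p.+1 + j) == y) = \sum_(j < q') (W (p + bump 0 j) == y).
    by apply: eq_bigr => j _; rewrite /bump /= addnA addn1 .
  by rewrite addSn addnS addnC addnA.
have ctR y p : i <= p -> p + q <= b -> ct y p = ct y i.
  elim: p => [|p IH] ip pb; first by have -> : nat_of_ord i = 0 by lia.
  have [ip'|ip'] := leqP i p; last by have -> : nat_of_ord i = p.+1 by lia.
  have := ctS y p; rewrite -run // => /eqP; rewrite eqn_add2r => /eqP ->; apply: IH; lia.
have ctb : ct (W b) (b - q).+1 = (ct (W b) i).+1.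
  have := ctS (W b) (b - q); rewrite (ctR _ (b - q)); [|lia|lia].
  have -> : b - q + q = b by lia.
  by move/eqP/negPf: brk => ->; rewrite eqxx addn0 addn1.
(* the starting points of [e + 1] windows: a period of the run, then those that
   reach beyond its end *)
pose p x := if x < q then i + x else b - e + (x - q).+1.
have [|x [y [xy ye E]]] := @window_collision w p Lw.
  by move=> x xe; rewrite /p -/n; case: ltnP; lia.
rewrite -/W in E.
have [yq|yq] := ltnP y q.
  have [|||m me] := min (i + x) (i + y); [lia|lia|lia|].
  by have := E _ me; rewrite /p yq ifT ?(ltn_trans xy).
have pi : i <= p x by rewrite /p; case: ltnP; lia.
have [ye'|ye'] := ltnP y e; last first.
  (* the last window starts with a word whose letter content differs from that
     of every factor of length q of the run *)
  have pye : p y = (b - q).+1 by rewrite /p ltnNge yq /=; lia.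
  have : ct (W b) (p x) = ct (W b) (p y).
    by apply: eq_bigr => m _; rewrite E //; have := ltn_ord m; lia.
  rewrite pye ctb ctR //; first by lia.
  by rewrite /p; case: ltnP; lia.
(* in window y the period q first breaks where window x is still periodic *)
have pyE : p y = b - e + (y - q).+1 by rewrite /p ltnNge yq.
set m := e - (y - q).+1 - q.
have h1 : p y + m = b - q by rewrite pyE /m; lia.
have h2 : p y + (m + q) = b by rewrite pyE /m; lia.
apply: brk; rewrite -h1 -[in RHS]h2 -!E; [|rewrite /m; lia|rewrite /m; lia].
rewrite addnA; apply: run; first by lia.
by rewrite /p /m; case: (ltnP x q); lia.
Qed.

(** By [bergman_structure], a long word is determined by its first [2 e]
letters, its last [e] letters, and three numbers at most [e]. *)
Lemma bergman_gap : exists K, forall n, count_len L n <= K.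
Proof.
pose S : finType := ('I_e.+1 * 'I_e.+1 * 'I_e.+1 * ((2 * e).-tuple T * e.-tuple T))%type.
exists (#|S| + #|T|.+1 ^ (2 * e)) => n.
have [n2|n2] := ltnP n (2 * e).
  apply: leq_trans (leq_addl _ _); apply: leq_trans (count_len_max _ _) _.
  apply: (@leq_trans (#|T|.+1 ^ n)); first by case: (n) => [|n'] //; rewrite leq_exp2r.
  by rewrite leq_pexp2l // ltnW.
apply: leq_trans (leq_addr _ _).
pose spec (w : n.-tuple T) (z : 'I_e.+1 * 'I_e.+1 * 'I_e.+1) :=
  [/\ z.1.1 + z.1.2 <= e, 0 < z.1.2 &
    forall m, z.1.1 <= m -> m + z.1.2 < n - z.2 -> nth x0 w m = nth x0 w (m + z.1.2)].
have /choice[z zP] : forall w : n.-tuple T, exists z, L w -> spec w z.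
  move=> w; have [Lw|nLw] := pselect (L w); last by exists (ord0, ord0, ord0).
  have [|i [q [s [iq q0 se h]]]] := bergman_structure Lw; first by rewrite size_tuple.
  have ie : i < e.+1 by lia.
  have qe : q < e.+1 by lia.
  exists (Ordinal ie, Ordinal qe, Ordinal (se : s < e.+1)) => _; split=> //=.
  by move=> m im ms; apply: h => //; rewrite size_tuple.
pose f (w : n.-tuple T) : S :=
  (z w, ([tuple nth x0 w i | i < 2 * e], [tuple nth x0 w (n - e + i) | i < e])).
apply: (@count_len_le _ _ _ f) => w w' Lw Lw' [zz h1 h2].
have [iq q0 per] := zP _ Lw; have [_ _ per'] := zP _ Lw'; rewrite -zz in per'.
have pre m : m < 2 * e -> nth x0 w m = nth x0 w' m.
  by move=> me; have /eq_in_map/(_ (Ordinal me)) := h1; rewrite mem_enum; apply.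
have suf m : n - e <= m -> m < n -> nth x0 w m = nth x0 w' m.
  move=> m1 m2; have me : m - (n - e) < e by lia.
  have /eq_in_map/(_ (Ordinal me)) := h2.
  by rewrite mem_enum /= subnKC //; apply.
apply/val_inj/(@eq_from_nth _ x0); rewrite !size_tuple // => m mn.
have := ltn_ord (z w).2.
elim/ltn_ind: m mn => m IH mn se.
have [m2|m2] := ltnP m (2 * e); first exact: pre.
have [ms|ms] := leqP (n - (z w).2) m; first by apply: suf; lia.
have mE : m = m - (z w).1.2 + (z w).1.2 by lia.
rewrite [in LHS]mE [in RHS]mE -per; [|lia|lia].
by rewrite -per'; [apply: IH; lia|lia|lia].
Qed.

End Bergman.
End Words.

(** * Periodic languages and the words that leave them *)

Section Periodic.
Local Open Scope nat_scope.
Local Open Scope classical_set_scope.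
Variable T : finType.
Implicit Types (L : set (seq T)) (u v w : seq T) (c : nat -> T).

Definition stretch c i n := [seq c m | m <- iota i n].

Definition factors c : set (seq T) := [set u | exists i, u = stretch c i (size u)].

Definition has_period c q := 0 < q /\ forall m, c (m + q) = c m.

Lemma size_stretch c i n : size (stretch c i n) = n.
Proof. by rewrite size_map size_iota. Qed.

Lemma nth_stretch x0 c i n m : m < n -> nth x0 (stretch c i n) m = c (i + m).
Proof. by move=> mn; rewrite (nth_map 0) ?size_iota // nth_iota. Qed.

Lemma stretch_cat c i n m : stretch c i (n + m) = stretch c i n ++ stretch c (i + n) m.
Proof. by rewrite /stretch iotaD map_cat. Qed.

Lemma factors_stretch c i n : factors c (stretch c i n).
Proof. by exists i; rewrite size_stretch. Qed.

Lemma stretch_cat_eq c i u v : u ++ v = stretch c i (size (u ++ v)) ->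
  u = stretch c i (size u) /\ v = stretch c (i + size u) (size v).
Proof.
rewrite size_cat stretch_cat => /eqP; rewrite eqseq_cat ?size_stretch //.
by case/andP => /eqP ? /eqP.
Qed.

Lemma factors_closed c : factor_closed (factors c).
Proof.
move=> a u b [i /stretch_cat_eq[_ /stretch_cat_eq[h _]]].
by exists (i + size a).
Qed.

Lemma periodicM c q a m : has_period c q -> c (m + a * q) = c m.
Proof.
case=> _ h; elim: a => [|a IH]; first by rewrite addn0.
by rewrite mulSn addnCA addnC h.
Qed.

Lemma stretch_shift c q a i n : has_period c q -> stretch c (i + a * q) n = stretch c i n.
Proof.
move=> pc; apply: (@eq_from_nth _ (c 0)); rewrite !size_stretch // => m mn.
by rewrite !nth_stretch // addnAC (periodicM _ _ pc).
Qed.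

(** Every stretch of a periodic sequence occurs again in any window of one
period. *)
Lemma stretch_in_window c q l p n : has_period c q ->
  exists2 p', l <= p' < l + q & stretch c p n = stretch c p' n.
Proof.
move=> pc; have q0 := pc.1.
exists (l + (p + l * q - l) %% q); first by rewrite leq_addr ltn_add2l ltn_pmod.
rewrite -(stretch_shift l _ _ pc).
rewrite -[in RHS](stretch_shift ((p + l * q - l) %/ q) _ _ pc).
congr stretch; have := divn_eq (p + l * q - l) q; nia.
Qed.

(** A long factor of a periodic sequence contains all the much shorter ones, so
a sequence that shares arbitrarily long factors with it has all of its factors.
*)
Lemma factors_sub c c' q : has_period c q ->
  (forall n, exists w, [/\ n <= size w, factors c w & factors c' w]) ->
  factors c `<=` factors c'.
Proof.
move=> pc h u [p uE]; have [w [sw [l wE] c'w]] := h (size u + q).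
have [p' /andP[lp pl] pE] := stretch_in_window l p (size u) pc.
rewrite uE pE; move: c'w; rewrite wE.
have -> : size w = (p' - l) + (size u + (size w - size u - (p' - l))) by lia.
rewrite !stretch_cat => /factors_closed.
by have -> : l + (p' - l) = p' by lia.
Qed.

Lemma factors_inter c c' q q' : has_period c q -> has_period c' q' ->
  factors c <> factors c' ->
  exists N, forall w, N <= size w -> factors c w -> ~ factors c' w.
Proof.
move=> pc pc' ne; apply: contrapT => h; apply: ne.
have {}h n : exists w, [/\ n <= size w, factors c w & factors c' w].
  apply: contrapT => nw; apply: h; exists n => w nw' cw c'w.
  by apply: nw; exists w.
apply/seteqP; split; first exact: (factors_sub pc).
by apply: (factors_sub pc') => n; have [w [? ? ?]] := h n; exists w.
Qed.

(** Past one period the next letter of a factor is forced, so it does not depend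
on how far the factor reaches to the left. *)
Lemma factors_rcons c q x u a : has_period c q -> q <= size u ->
  factors c (x ++ u) -> factors c (rcons u a) -> factors c (x ++ rcons u a).
Proof.
move=> [q0 pc] qu [i xuE] [j uaE].
have [xE uE] := stretch_cat_eq xuE.
move: uaE; rewrite -cats1 => /stretch_cat_eq[uE' [aE]].
exists i; rewrite catA size_cat stretch_cat -xuE; congr (_ ++ _).
rewrite /= aE; congr [:: _]; rewrite size_cat.
have h : c (i + size x + (size u - q)) = c (j + (size u - q)).
  have uq : size u - q < size u by lia.
  by rewrite -(nth_stretch a c (i + size x) uq) -(nth_stretch a c j uq) -uE -uE'.
have := pc (i + size x + (size u - q)); have := pc (j + (size u - q)).
have -> : j + (size u - q) + q = j + size u by lia.
have -> : i + size x + (size u - q) + q = i + (size x + size u) by lia.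
by move=> -> ->; rewrite h.
Qed.

Lemma factors_split c w n : factors c (take n w) -> ~ factors c w ->
  exists p, [/\ n <= p, p < size w, factors c (take p w) & ~ factors c (take p.+1 w)].
Proof.
move=> cn nw; pose Q p := `[< factors c (take p w) >].
have ns : n < size w.
  by rewrite ltnNge; apply/negP => h; apply: nw; rewrite -(take_oversize h).
have Qs p : (p <= size w) && Q p -> p <= size w by case/andP.
have exQ : exists p, (p <= size w) && Q p.
  by exists n; rewrite (ltnW ns); apply/asboolP.
case: (ex_maxnP exQ Qs) => p /andP[ps /asboolP Qp] pmax.
have psz : p < size w.
  rewrite ltn_neqAle ps andbT; apply/eqP => e.
  by apply: nw; rewrite -(take_size w) -e.
exists p; split=> //.
  by apply: pmax; rewrite (ltnW ns); apply/asboolP.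
move=> h; have : p.+1 <= p by apply: pmax; rewrite psz; apply/asboolP.
by rewrite ltnn.
Qed.

Section Exits.
Variable L : set (seq T).
Hypotheses (fL : factor_closed L) (iL : irreducible L).

Lemma extend_right w n a : L [:: a] -> L w -> exists w', L (w ++ w') /\ n <= size w'.
Proof.
move=> La Lw; elim: n => [|n [w' [Lw' sw']]].
  by exists [::]; rewrite cats0.
have [b Lb] := iL Lw' La; exists (w' ++ b ++ [:: a]).
by split; [move: Lb; rewrite !catA|rewrite !size_cat /=; lia].
Qed.

(** Irreducibility joins a factor of [c] to a word of [L] that is no factor of
[c].  Cut the result so that exactly [s] letters remain before it leaves [c],
then prolong it to the right. *)
Lemma exit_word c q n s : has_period c q -> factors c `<=` L -> factors c <> L ->
  q <= s -> s < n -> exists w, [/\ L w, size w = n, factors c (take s w)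
    & ~ factors c (take s.+1 w)].
Proof.
move=> pc cL ncL qs sn.
have [r Lr cr] : exists2 r, L r & ~ factors c r.
  apply: contrapT => h; apply: ncL; apply/seteqP; split => // r Lr.
  by apply: contrapT => cr; apply: h; exists r.
have Ly : L (stretch c 0 s) by apply/cL/factors_stretch.
have [b Lybr] := iL Ly Lr.
set W := _ ++ _ in Lybr.
have cW : ~ factors c W.
  move=> h; apply: cr; move: h; rewrite /W catA => h.
  by apply: (factors_closed (a := stretch c 0 s ++ b) (b := [::])); rewrite cats0.
have csW : factors c (take s W).
  by rewrite /W take_size_cat ?size_stretch //; apply: factors_stretch.
have [p [sp pW cp ncp]] := factors_split csW cW.
have La : L [:: c 0] by apply: cL; exists 0.
pose W' := drop (p - s) W.
have LW' : L W' by apply: factor_drop.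
have [w' [Lw' nw']] := extend_right n La LW'.
have sW' : s < size W' by rewrite size_drop; lia.
exists (take n (W' ++ w')); split.
- exact: factor_take.
- by rewrite size_takel // size_cat; lia.
- rewrite take_takel; last exact: ltnW.
  rewrite takel_cat ?(ltnW sW') // /W' take_drop subnKC //.
  rewrite (_ : take p W = take (p - s) (take p W) ++ drop (p - s) (take p W) ++ [::]) in cp.
    by move/factors_closed: cp.
  by rewrite cats0 cat_take_drop.
rewrite take_takel // takel_cat // => h; apply: ncp.
have x0 := c 0.
have uE : take s.+1 W' = rcons (take s W') (nth x0 W' s) by rewrite (take_nth x0).
have pE : take p.+1 W = take (p - s) W ++ take s.+1 W'.
  have -> : p.+1 = (p - s) + s.+1 by lia.
  by rewrite takeD.
rewrite pE uE; apply: (factors_rcons pc).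
- by rewrite size_takel // ltnW.
- by rewrite /W' -takeD subnK.
- by rewrite -uE.
Qed.

(** The words given by [exit_word] for distinct pairs (sequence, exit time) are
distinct: the exit time is read off the word, and a prefix longer than all the
words that two of the languages share belongs to one of them only. *)
Lemma exit_count m (c : 'I_m -> nat -> T) (q : 'I_m -> nat) :
  (forall i, has_period (c i) (q i)) -> (forall i, factors (c i) `<=` L) ->
  (forall i, factors (c i) <> L) ->
  (forall i j, i != j -> factors (c i) <> factors (c j)) ->
  exists N, forall n, m * (n - N) <= count_len L n.
Proof.
move=> pc cL ncL cc.
have /choice[N1 N1P] : forall ij : 'I_m * 'I_m, exists N, ij.1 != ij.2 -> forall w,
    N <= size w -> factors (c ij.1) w -> ~ factors (c ij.2) w.
  move=> [i j] /=; have [->|ij] := eqVneq i j; first by exists 0.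
  by have [N NP] := factors_inter (pc i) (pc j) (cc _ _ ij); exists N.
(* beyond the periods for [exit_word], beyond the common words for distinctness *)
pose N := maxn (\max_i q i) (\max_ij N1 ij).
exists N => n.
have /choice[f fP] : forall z : 'I_m * 'I_(n - N), exists w,
    [/\ L w, size w = n, factors (c z.1) (take (N + z.2) w)
      & ~ factors (c z.1) (take (N + z.2).+1 w)].
  move=> [i s]; apply: (@exit_word _ (q i)) => //=.
    by apply: leq_trans (leq_addr _ _); apply: leq_trans (leq_maxl _ _); apply: leq_bigmax.
  by have := ltn_ord s; lia.
have Lf z : L (f z) by case: (fP z).
have sf z : size (f z) = n by case: (fP z).
have := count_len_ge Lf sf; rewrite card_prod !card_ord; apply.
move=> [i s] [j t] e.
have /= [_ _ h1 h2] := fP (i, s); have /= [_ _ h3 h4] := fP (j, t).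
rewrite -e in h3 h4; set w := f _ in h1 h2 h3 h4.
have ij : i = j.
  apply/eqP; apply: contrapT => /negP ij.
  have Nn : N <= n by have := ltn_ord s; lia.
  have NE r c' : factors c' (take (N + r) w) -> factors c' (take N w).
    rewrite takeD -[_ ++ _]/([::] ++ take N w ++ take r (drop N w)).
    exact: factors_closed.
  apply: (N1P (i, j) ij (take N w)); last exact: NE h3; last exact: NE h1.
  rewrite size_takel ?sf //; apply: leq_trans (leq_maxr _ _).
  exact: (leq_bigmax (i, j)).
move: h3 h4; rewrite -{}ij => h3 h4.
have sub a b : a < b -> factors (c i) (take (N + b) w) -> factors (c i) (take (N + a).+1 w).
  move=> ab; have -> : N + b = (N + a).+1 + (b - a.+1) by lia.
  rewrite takeD -[_ ++ _]/([::] ++ take (N + a).+1 w ++ take _ (drop _ w)).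
  exact: factors_closed.
congr (_, _); apply: val_inj => /=.
case: (ltngtP s t) => // lt; exfalso; first exact/h2/(sub _ _ lt h3).
exact/h4/(sub _ _ lt h1).
Qed.

End Exits.

(** Two distinct words of the same length generate a free monoid. *)
Lemma exponential_count L X Y l : size X = l -> size Y = l -> X <> Y ->
  (forall s : seq bool, L (flatten [seq if b then X else Y | b <- s])) ->
  forall n, 2 ^ n <= count_len L (n * l).
Proof.
move=> sX sY XY LXY n.
pose f (t : n.-tuple bool) := flatten [seq if b then X else Y | b <- t].
have szf (s : seq bool) : size (flatten [seq if b then X else Y | b <- s]) = size s * l.
  by elim: s => //= b s IH; rewrite size_cat IH mulSn; case: b; rewrite ?sX ?sY.
have -> : 2 ^ n = #|{: n.-tuple bool}| by rewrite card_tuple card_bool.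
apply: (@count_len_ge _ _ _ _ f) => [t|t|t t' ft]; [exact: LXY|by rewrite szf size_tuple|].
apply/val_inj => /=; move: ft; rewrite /f.
have : size t = size t' by rewrite !size_tuple.
move: (tval t) (tval t'); elim=> [|b s IH] [|b' s'] //= [ss] /eqP.
rewrite eqseq_cat; last by case: b; case: b'; rewrite ?sX ?sY.
case/andP=> /eqP e /eqP /(IH _ ss) ->; congr (_ :: _).
by case: b b' e => -[] // e; case: XY.
Qed.

(** A word that commutes with [v] is a prefix of a power of [v]. *)
Lemma commuting_periodic (x0 : T) L v : factor_closed L -> v <> [::] ->
  (forall n, L (flatten (nseq n v))) ->
  (forall a, L a -> exists b b', (b ++ a ++ b') ++ v = v ++ (b ++ a ++ b')) ->
  exists c, has_period c (size v) /\ L = factors c.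
Proof.
move=> fL v0 Lv comm; pose c m := nth x0 v (m %% size v).
have sv : 0 < size v by case: (v) v0.
have pc : has_period c (size v) by split => // m; rewrite /c modnDr.
have vE n : flatten (nseq n v) = stretch c 0 (n * size v).
  elim: n => // n IH; rewrite /= IH mulSn stretch_cat; congr (_ ++ _).
    apply: (@eq_from_nth _ x0); rewrite ?size_stretch // => m mv.
    by rewrite nth_stretch // /c modn_small.
  by have := stretch_shift 1 0 (n * size v) pc; rewrite mul1n.
exists c; split=> //; apply/seteqP; split=> [a La|a [i ->]]; last first.
  have := Lv (i + size a); rewrite vE.
  have -> : (i + size a) * size v = i + (size a + ((i + size a) * size v - i - size a)) by nia.
  by rewrite !stretch_cat => /fL.
have [b [b' sv_comm]] := comm _ La; set s := b ++ a ++ b' in sv_comm.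
have E n : s ++ flatten (nseq n v) = flatten (nseq n v) ++ s.
  by elim: n => [|n IH]; rewrite /= ?cats0 // catA sv_comm -catA IH catA.
have := E (size s); rewrite vE => /eqP.
rewrite {2}(_ : size s * size v = size s + (size s * size v - size s)); last by nia.
rewrite stretch_cat -catA eqseq_cat ?size_stretch // => /andP[/eqP sE _].
by apply: (factors_closed (a := b) (b := b')); rewrite -/s sE; apply: factors_stretch.
Qed.

End Periodic.

(** * The degree-lexicographic order *)

Section CountB.
Local Open Scope nat_scope.
Variable T : finType.

Definition count_upto (L : set (seq T)) n := #|[pred w : n.-bseq T | `[< L w >]]|.

Lemma count_uptoE L n : count_upto L n = \sum_(i < n.+1) count_len L i.
Proof.
rewrite /count_upto -sum1_card (reindex (@tagged_tuple_bseq n T)) /=; last exact: onW_bij.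
under [RHS]eq_bigr do rewrite /count_len -sum1_card.
by rewrite sig_big_dep.
Qed.

End CountB.

Section Key.
Local Open Scope nat_scope.
Variable d : nat.
Implicit Types u v w : seq 'I_d.

(** The degree-lexicographic order is the order of numerals in base [d + 1] with
digits [1], ..., [d]. *)
Definition deglex w := foldl (fun m (i : 'I_d) => m * d.+1 + i.+1) 0 w.

Lemma deglex_rcons w i : deglex (rcons w i) = deglex w * d.+1 + i.+1.
Proof. by rewrite /deglex -cats1 foldl_cat. Qed.

Lemma deglex_cat u v : deglex (u ++ v) = deglex u * d.+1 ^ size v + deglex v.
Proof.
elim/last_ind: v => [|v i IH]; first by rewrite cats0 muln1 addn0.
by rewrite -rcons_cat !deglex_rcons IH size_rcons expnS; nia.
Qed.

Lemma deglex_lt w : deglex w < d.+1 ^ size w.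
Proof.
elim/last_ind: w => // w i IH; rewrite deglex_rcons size_rcons expnS.
have := leq_mul IH (leqnn d.+1); have := ltn_ord i; nia.
Qed.

Lemma deglex_ge n w : n < size w -> d.+1 ^ n <= deglex w.
Proof.
elim/last_ind: w n => // w i IH [|n]; rewrite size_rcons deglex_rcons.
  by rewrite expn0; lia.
by rewrite ltnS => /IH; rewrite expnS; nia.
Qed.

Lemma deglex_inj : injective deglex.
Proof.
elim/last_ind=> [|u i IH] v; case/lastP: v => [|v j] //; rewrite ?deglex_rcons.
- by rewrite /deglex /=; lia.
- by rewrite /deglex /=; lia.
move=> e; have hi := ltn_ord i; have hj := ltn_ord j.
have e1 : deglex u = deglex v.
  by have := congr1 (divn ^~ d.+1) e; rewrite !divnMDl // !divn_small // !addn0.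
have e2 : i = j by apply: val_inj => /=; move: e; rewrite e1; lia.
by rewrite (IH _ e1) e2.
Qed.

Lemma deglex_size u v : deglex u < deglex v -> size u <= size v.
Proof.
move=> uv; rewrite leqNgt; apply/negP => /deglex_ge.
by have := deglex_lt v; lia.
Qed.

Lemma deglex_context a u u' b : deglex u' < deglex u -> deglex (a ++ u' ++ b) < deglex (a ++ u ++ b).
Proof.
move=> uu; rewrite !deglex_cat !size_cat -addSn.
have h : d.+1 ^ (size u' + size b) <= d.+1 ^ (size u + size b).
  by rewrite leq_pexp2l // leq_add2r deglex_size.
have : deglex u' * d.+1 ^ size b + deglex b < deglex u * d.+1 ^ size b + deglex b.
  by rewrite ltn_add2r ltn_pmul2r // expn_gt0.
by have := leq_mul (leqnn (deglex a)) h; lia.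
Qed.

End Key.

(** * Algebras generated by finitely many letters *)

Section Generated.
Variables (k : fieldType) (d : nat) (A : algType k) (a : 'I_d -> A).
Implicit Types (u v w : seq 'I_d) (x y z : A).

Definition wval w : A := \prod_(i <- w) a i.

Definition wspan n : set A := lin_span [set wval w | w in [set w | (size w <= n)%N]].

Definition nonzero_words : set (seq 'I_d) := [set w | wval w != 0].

Lemma wval_cat u v : wval (u ++ v) = wval u * wval v.
Proof. exact: big_cat. Qed.

Lemma wval1 i : wval [:: i] = a i.
Proof. exact: big_seq1. Qed.

Lemma wspan_subspace n : vsubspace (wspan n).
Proof. exact: lin_span_subspace. Qed.

Lemma wspan_wval n w : (size w <= n)%N -> wspan n (wval w).
Proof. by move=> wn; apply: sub_lin_span; exists w. Qed.

Lemma wspan_mono n m : (n <= m)%N -> wspan n `<=` wspan m.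
Proof.
by move=> nm; apply: lin_span_mono => _ [w /= wn <-]; exists w => //=; apply: leq_trans nm.
Qed.

Lemma wspan_mul n m x y : wspan n x -> wspan m y -> wspan (n + m)%N (x * y).
Proof.
apply: lin_spanM => _ _ [u /= un <-] [v /= vm <-].
by rewrite -wval_cat; apply: wspan_wval; rewrite size_cat leq_add.
Qed.

Lemma wspan1 n : wspan n 1.
Proof. by have := @wspan_wval n [::] isT; rewrite /wval big_nil. Qed.

Lemma wspan_bseq n x : wspan n x <->
  exists c : n.-bseq 'I_d -> k, x = \sum_(w : n.-bseq 'I_d) c w *: wval w.
Proof.
rewrite -lin_span_rangeP; have -> : wspan n = lin_span (range (fun w : n.-bseq 'I_d => wval w)) => //.
congr lin_span; apply/seteqP; split=> y [w].
  by move=> wn <-; exists (Bseq wn).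
by move=> _ <-; exists w => //=; apply: size_bseq.
Qed.

Lemma wspan_finite n : exists N, dim_le (wspan n) N.
Proof.
exists #|{: n.-bseq 'I_d}|.
apply: (@dim_le_span _ _ _ (fun w : n.-bseq 'I_d => wval w)) => x /wspan_bseq h.
exact/lin_span_rangeP.
Qed.

Lemma nonzero_words_closed : factor_closed nonzero_words.
Proof.
move=> u w v; rewrite /nonzero_words /= !wval_cat => h; apply: contra_neq h => ->.
by rewrite mul0r mulr0.
Qed.

Section NormalWords.

(** The words whose value is no combination of values of smaller words: they
index a basis of the algebra. *)
Definition normal : set (seq 'I_d) :=
  [set w | ~ lin_span [set wval u | u in [set u | (deglex u < deglex w)%N]] (wval w)].

Lemma normal_closed : factor_closed normal.
Proof.
move=> s w t; apply: contra_not; rewrite !wval_cat => ws.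
have E z : [set z] z -> lin_span [set z] z by move=> ?; apply: sub_lin_span.
apply: (@lin_spanM _ _ [set wval s] [set x * wval t | x in [set wval u | u in [set u | (deglex u < deglex w)%N]]]).
- move=> _ _ -> [_ [u /= uw <-] <-]; rewrite -!wval_cat; apply: sub_lin_span.
  by exists (s ++ u ++ t) => //=; apply: deglex_context.
- exact: E.
apply: lin_spanM ws (E _ erefl) => x _ [u /= uw <-] ->.
by apply: sub_lin_span; exists (wval u) => //; exists u.
Qed.

(** Replace a word that is not normal by smaller ones, and repeat; the lengths
do not increase. *)
Lemma normal_span w :
  lin_span [set wval u | u in [set u | normal u /\ (size u <= size w)%N]] (wval w).
Proof.
have [m] := ubnP (deglex w); elim: m w => // m IH w km.
have [nw|/contrapT] := pselect (normal w).
  by apply: sub_lin_span; exists w.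
apply: lin_span_le => _ [u /= uw <-].
apply: lin_span_mono (IH u _); last by lia.
move=> _ [v /= [nv vu] <-]; exists v => //=; split=> //.
exact/(leq_trans vu)/deglex_size.
Qed.

(** The largest word of a relation would not be normal. *)
Lemma normal_indep (T : finType) (f : T -> seq 'I_d) :
  injective f -> (forall t, normal (f t)) -> indep (wval \o f).
Proof.
move=> fi nf c E t0; apply/eqP/negPn/negP => ct0.
case: (@arg_maxnP _ t0 (fun t => c t != 0) (fun t => deglex (f t)) ct0) => t ct tmax.
apply: (nf t); move: E; rewrite (bigD1 t) //= => /eqP; rewrite addr_eq0 => /eqP E.
have -> : wval (f t) = (c t)^-1 *: (c t *: wval (f t)) by rewrite scalerA mulVf // scale1r.
have sL := lin_span_subspace.
rewrite E; apply: (subspaceZ _ (sL _ _ _)); apply: (subspaceN (sL _ _ _)).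
apply: (subspace_sum _ (sL _ _ _)) => t' tt'.
have [->|ct'] := eqVneq (c t') 0.
  by rewrite scale0r; case: (sL _ _ [set wval u | u in [set u | (deglex u < deglex (f t))%N]]).
apply: (subspaceZ _ (sL _ _ _)); apply: sub_lin_span; exists (f t') => //=.
rewrite ltn_neqAle (tmax _ ct' : (deglex (f t') <= deglex (f t))%N) andbT.
by apply: contra_neq tt' => /deglex_inj/fi.
Qed.

Lemma normal_count_upto n N : dim_le (wspan n) N -> (count_upto normal n <= N)%N.
Proof.
move=> bN; pose S := {w : n.-bseq 'I_d | `[< normal w >]}.
have -> : count_upto normal n = #|{: S}| by rewrite card_sig.
apply: (bN _ (wval \o (fun w : S => val w : seq 'I_d))).
  by move=> w /=; apply: wspan_wval; apply: size_bseq.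
apply: normal_indep; first by move=> w w' /val_inj/val_inj.
by move=> [w hw] /=; apply/asboolP.
Qed.

Lemma wspan_dim_normal n : dim_le (wspan n) (count_upto normal n).
Proof.
pose S := {w : n.-bseq 'I_d | `[< normal w >]}.
have -> : count_upto normal n = #|{: S}| by rewrite card_sig.
apply: (@dim_le_span _ _ _ (wval \o (fun w : S => val w : seq 'I_d))).
apply: lin_span_le => _ [w /= wn <-].
apply: lin_span_mono (@normal_span w) => _ [u /= [nu uw] <-].
have un : (size u <= n)%N by apply: leq_trans wn.
by exists (exist _ (Bseq un) (asboolT nu)).
Qed.

(** If there were more than [e] normal words of every length [e], the span of
the words of length at most [n] would have dimension at least [1 + 2 + ... + (n
+ 1)]; so [bergman_gap] applies to the normal words. *)
Lemma linear_growth (x0 : 'I_d) n N :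
  dim_le (wspan n) N -> (2 * N < n.+1 * n.+2)%N ->
  exists K, forall m, dim_le (wspan m) (K * m.+1)%N.
Proof.
move=> /normal_count_upto bN Nn.
have [e le] : exists e, (count_len normal e <= e)%N.
  apply: contrapT => h; move: bN; rewrite count_uptoE => bN.
  have : (\sum_(i < n.+1) i.+1 <= \sum_(i < n.+1) count_len normal i)%N.
    by apply: leq_sum => i _; rewrite ltnNge; apply/negP => le; apply: h; exists i.
  have -> : (\sum_(i < n.+1) i.+1 = 'C(n.+2, 2))%N.
    by rewrite -bin2_sum big_mkord [RHS]big_ord_recl add0n.
  rewrite bin2 succnK => h'; have := odd_double_half (n.+2 * n.+1).
  by rewrite oddM !oddS; case: (odd n); rewrite ?andbF ?andFb add0n; lia.
have [K KP] := bergman_gap x0 normal_closed le.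
exists K => m; apply: dim_leS (@wspan_dim_normal m) => //.
rewrite count_uptoE; apply: (@leq_trans (\sum_(i < m.+1) K)); first by apply: leq_sum => i _; apply: KP.
by rewrite sum_nat_const card_ord mulnC.
Qed.

End NormalWords.

Section Prime.
Hypothesis gen : forall x, exists n, wspan n x.
Hypothesis prime : forall x y, x != 0 -> y != 0 -> exists z, x * z * y != 0.
Hypothesis infinite_dim : forall N, ~ dim_le (setT : set A) N.

Lemma exists_nonzero_letter : exists i, nonzero_words [:: i].
Proof.
apply: contrapT => h.
have wval0 w : lin_span (range (fun _ : unit => 1 : A)) (wval w).
  have [s0 _] := lin_span_subspace (range (fun _ : unit => 1 : A)).
  case: w => [|i w]; first by rewrite /wval big_nil; apply: sub_lin_span; exists tt.
  rewrite -cat1s wval_cat wval1 (_ : a i = 0) ?mul0r //.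
  by apply/eqP/negPn/negP => ai; apply: h; exists i; rewrite /nonzero_words /= wval1.
apply: (@infinite_dim #|{: unit}|); apply: dim_le_span => x _.
by have [n] := gen x; apply: lin_span_le => _ [w _ <-]; exact: wval0.
Qed.

Lemma nonzero_words_irreducible : irreducible nonzero_words.
Proof.
move=> u v nu nv; have [z] := prime nu nv; apply: contra_neqP => h.
have [n] := gen z; apply: (lin_span_min (U := [set z | wval u * z * wval v = 0])).
  split=> [|b x y /= h1 h2] /=; first by rewrite mulr0 mul0r.
  by rewrite mulrDr mulrDl -scalerAr -scalerAl h1 h2 scaler0 addr0.
move=> _ [b _ <-] /=; apply/eqP/negPn/negP => hb; apply: h.
by exists b; rewrite /nonzero_words /= !wval_cat mulrA.
Qed.

Local Notation rideal y n := [set y * x | x in wspan n].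

(** If the chain stopped, [yA] would be finite-dimensional, and so some nonzero
[b] would annihilate it on the right, against primeness. *)
Lemma right_ideal_stable y n : y != 0 -> ~ (rideal y n.+1 `<=` rideal y n).
Proof.
move=> y0 st.
have sY m : vsubspace (rideal y m) by apply/subspace_mulL/wspan_subspace.
have stable m : rideal y m `<=` rideal y n.
  elim: m => [|m IH].
    by apply: subset_trans st => _ [x bx <-]; exists x => //; apply: wspan_mono bx.
  move=> _ [x bx <-]; move: bx.
  apply: (lin_span_min (U := [set x | rideal y n (y * x)])).
    split=> [|c x' x'' h1 h2] /=; first by rewrite mulr0; case: (sY n).
    by rewrite mulrDr -scalerAr; case: (sY n) => _; apply.
  move=> _ [w /= wm <-]; case/lastP: w wm => [|w i] wm.
    by apply: IH; exists (wval [::]) => //; apply: wspan_wval.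
  rewrite size_rcons ltnS in wm.
  have [x' bx' xE] : rideal y n (y * wval w) by apply: IH; exists (wval w) => //; apply: wspan_wval.
  apply: st; exists (x' * a i).
    by rewrite -addn1 -wval1; apply: wspan_mul => //; apply: wspan_wval.
  by rewrite mulrA xE -cats1 wval_cat wval1 mulrA.
have stableA z : rideal y n (y * z).
  by have [m bz] := gen z; apply: (stable m); exists z.
have [N bN] := wspan_finite n.
have YN : dim_le (rideal y n) (N - #|{: void}|).
  have [|||h _] := @dim_le_ker _ _ (wspan n) N y void (fun t : void => match t with end) bN; [by case|by case|by move=> c _ []|exact: h].
have [r [e [ie eY]]] := dim_le_basis (sY n) YN.
(* right multiplication by b on the finite-dimensional ideal, in coordinates *)
have /choice[m mE] : forall ib : 'I_r * A, exists c : 'I_r -> k,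
    e ib.1 * ib.2 = \sum_j c j *: e j.
  move=> [i b] /=; apply/lin_span_rangeP; rewrite eY.
  have [x bx <-] : rideal y n (e i) by rewrite -eY; apply: sub_lin_span; exists i.
  by rewrite -mulrA.
apply: (@infinite_dim (r * r)%N) => T b _ ib.
rewrite leqNgt; apply/negP => rT.
have rT' : (#|{: 'I_r * 'I_r}| < #|T|)%N by rewrite card_prod card_ord.
have [c [t ct] c0] := tall_relation (fun t (ij : 'I_r * 'I_r) => m (ij.1, b t) ij.2) rT'.
have b0 : \sum_t c t *: b t != 0 by apply/eqP => /ib/(_ t) h; rewrite h eqxx in ct.
have [z] := prime y0 b0; apply: contra_neqP => _.
have : lin_span (range e) (y * z) by rewrite eY.
move/lin_span_rangeP=> [g ->]; rewrite mulr_suml big1 // => i _.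
rewrite -scalerAl mulr_sumr.
suff -> : \sum_t e i * (c t *: b t) = 0 by rewrite scaler0.
transitivity (\sum_t \sum_j (c t * m (i, b t) j) *: e j).
  apply: eq_bigr => t' _; rewrite -scalerAr (mE (i, b t')) scaler_sumr.
  by apply: eq_bigr => j _; rewrite scalerA.
rewrite exchange_big big1 // => j _ /=.
by rewrite -scaler_suml (c0 (i, j)) scale0r.
Qed.

Lemma right_ideal_growth y n : y != 0 ->
  exists2 f : 'I_n -> A, forall i, rideal y n (f i) & indep f.
Proof.
move=> y0; have sY m : vsubspace (rideal y m) by apply/subspace_mulL/wspan_subspace.
have mono i j : (i <= j)%N -> rideal y i `<=` rideal y j.
  by move=> ij _ [x bx <-]; exists x => //; apply: wspan_mono bx.
have /choice[g gP] : forall i, exists z, rideal y i.+1 z /\ ~ rideal y i z.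
  move=> i; apply: contrapT => h; apply: (@right_ideal_stable y i y0) => z z1.
  by apply: contrapT => z2; apply: h; exists z.
pose z i := if i is j.+1 then g j else y.
have zP i : rideal y i (z i).
  by case: i => [|i] /=; [exists 1; [exact: wspan1|rewrite mulr1]|case: (gP i)].
exists (fun i : 'I_n => z i).
  by move=> i; apply: mono (zP i); apply: ltnW.
by apply: (indep_chain sY mono) => // i; case: (gP i).
Qed.

(** [rank_le w r] says that the growth of [wA] has slope at most [r]. *)
Definition rank_le w r := exists c, forall n, dim_le (rideal (wval w) n) (r * n + c)%N.

(** A nonzero element killed on the left by [wu] generates a right ideal of
slope at least one inside the kernel, so the right ideal of [wuw] would have a
smaller slope than that of [w]. *)
Lemma minimal_rank K : (forall n, dim_le (wspan n) (K * n.+1)%N) ->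
  exists2 w, nonzero_words w & forall u x, nonzero_words (w ++ u ++ w) -> wval w * x != 0 ->
    wval (w ++ u) * (wval w * x) != 0.
Proof.
move=> bK.
pose Q r := `[< exists2 w, nonzero_words w & rank_le w r >].
have exQ : exists r, Q r.
  exists K; apply/asboolP; exists [::]; first by rewrite /nonzero_words /= /wval big_nil oner_neq0.
  exists K => n; apply: dim_leS (bK n); last by rewrite mulnS addnC.
  by move=> _ [x bx <-]; rewrite /wval big_nil mul1r.
case: (ex_minnP exQ) => r /asboolP[w nw [c wc]] rmin.
exists w => // u x nwuw y0; apply/negP => /eqP uy.
have [c0 bx] := gen x; set y := wval w * x in y0 uy.
(* passing from [w] to [w ++ u ++ w] loses at least [n - c0] dimensions *)
have step n : dim_le (rideal (wval (w ++ u ++ w)) n) ((r * n + c) - (n - c0)) /\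
    (n - c0 <= r * n + c)%N.
  have [f fy fi] := right_ideal_growth (n - c0) y0.
  have [] := @dim_le_ker _ _ (rideal (wval w) n) _ (wval (w ++ u)) _ f (wc n).
  - move=> t; have cn : (c0 <= n)%N by have := ltn_ord t; lia.
    have [z bz <-] := fy t; exists (x * z); last by rewrite mulrA.
    by rewrite -(subnKC cn); apply: wspan_mul.
  - by move=> t; have [z bz <-] := fy t; rewrite mulrA uy mul0r.
  - exact: fi.
  rewrite card_ord => h1 h2; split=> //.
  apply: dim_leS h1 => // _ [z bz <-].
  by exists (wval w * z); [exists z|rewrite mulrA -wval_cat -catA].
case: r rmin wc step => [|r] rmin wc step.
  by have := (step (c0 + c).+1).2; lia.
have : Q r.
  apply/asboolP; exists (w ++ u ++ w) => //; exists (c0 + c)%N => n.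
  apply: dim_leS (step n).1 => //; lia.
by move/rmin; rewrite ltnn.
Qed.

Lemma exp_beats_quadratic K l : exists n, (K * (n * l).+1 ^ 2 < 2 ^ n)%N.
Proof.
pose m := (16 * (K * l.+1 ^ 2)).+1.
(* [2 ^ (4 m) >= (m + 1) ^ 4], while the left-hand side is at most
   [16 K (l + 1) ^ 2 (m + 1) ^ 2] *)
exists (4 * m)%N; rewrite (mulnC 4) [in X in (_ < X)%N]expnM.
have h : (m.+1 ^ 4 <= (2 ^ m) ^ 4)%N by rewrite leq_exp2r // ltn_expl.
apply: leq_trans h.
apply: (@leq_ltn_trans (K * (4 * m.+1 * l.+1) ^ 2)).
  by rewrite leq_mul2l leq_exp2r //; apply/orP; right; nia.
have -> : (K * (4 * m.+1 * l.+1) ^ 2 = (16 * (K * l.+1 ^ 2)) * m.+1 ^ 2)%N.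
  by rewrite !expnMn; lia.
rewrite (expnD _ 2 2) ltn_pmul2r ?expn_gt0 //.
by rewrite -[(m.+1 ^ 2)%N]mulnn /m; set X := (16 * _)%N; nia.
Qed.

(** The words [wu] with [wuw] nonzero, for the word [w] of [minimal_rank], are
closed under products; polynomial growth forces them to commute, and each
nonzero word occurs inside one of them. *)
Lemma nonzero_words_periodic K M : (forall n, dim_le (wspan n) (K * n.+1)%N) ->
  (forall n, (count_len nonzero_words n <= M * n.+1 ^ 2)%N) ->
  exists (c : nat -> 'I_d) (q : nat), has_period c q /\ nonzero_words = factors c.
Proof.
move=> bK cM; have [w nw inj] := minimal_rank bK.
have ret us : (forall u, u \in us -> nonzero_words (w ++ u ++ w)) ->
    exists x, wval (flatten [seq w ++ u | u <- us] ++ w) = wval w * x /\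
      nonzero_words (flatten [seq w ++ u | u <- us] ++ w).
  elim: us => [_|u us IH h]; first by exists 1; rewrite mulr1.
  have [|x [xE nx]] := IH; first by move=> v vus; apply: h; rewrite inE vus orbT.
  exists (wval u * (wval w * x)); rewrite /= -catA; split; first by rewrite wval_cat xE wval_cat -!mulrA.
  rewrite /nonzero_words /= wval_cat xE; apply: inj; first by apply: h; rewrite inE eqxx.
  by rewrite -xE.
have comm u u' : nonzero_words (w ++ u ++ w) -> nonzero_words (w ++ u' ++ w) ->
    (w ++ u) ++ (w ++ u') = (w ++ u') ++ (w ++ u).
  move=> nu nu'; apply: contrapT => ne.
  (* the two products have the same length *)
  set X := _ ++ _ in ne; set Y := _ ++ _ in ne.
  have sXY : size Y = size X by rewrite !size_cat; lia.
  have := @exponential_count _ nonzero_words X Y (size X) erefl sXY ne.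
  have [n nK] := exp_beats_quadratic M (size X).
  move=> /(_ _ n) h; have := cM (n * size X)%N.
  suff : (2 ^ n <= count_len nonzero_words (n * size X))%N by move: nK; lia.
  apply: h => s.
  pose us := flatten [seq if b then [:: u; u'] else [:: u'; u] | b <- s].
  have -> : flatten [seq if b then X else Y | b <- s] = flatten [seq w ++ v | v <- us].
    rewrite /us; elim: s {us} => //= b s ->; rewrite map_cat flatten_cat.
    by case: b; rewrite /X /Y /= cats0 !catA.
  have [|x [_]] := ret us.
    move=> v; rewrite /us; elim: s {us} => //= b s IH; rewrite mem_cat => /orP[|/IH//].
    by case: b; rewrite !inE => /orP[] /eqP ->.
  by move=> h'; apply: (nonzero_words_closed (a := [::]) (b := w)).
have [i ni] := exists_nonzero_letter.
have [b1 nb1] := nonzero_words_irreducible nw ni.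
have [b2 nb2] := nonzero_words_irreducible nb1 nw.
pose u0 := b1 ++ [:: i] ++ b2.
have nu0 : nonzero_words (w ++ u0 ++ w) by move: nb2; rewrite /u0 -!catA.
have vn n : nonzero_words (flatten (nseq n (w ++ u0))).
  have [|x [_ h]] := ret (nseq n u0); first by move=> u /nseqP[-> _].
  by rewrite map_nseq in h; apply: (nonzero_words_closed (a := [::]) (b := w)).
have v0 : w ++ u0 <> [::].
  by move/(congr1 size)/eqP; rewrite !size_cat /= !addnS.
have [|c [pc E]] := commuting_periodic i nonzero_words_closed v0 vn; last by exists c, (size (w ++ u0)).
move=> s ns; have [c1 nc1] := nonzero_words_irreducible nw ns.
have [c2 nc2] := nonzero_words_irreducible nc1 nw.
exists (w ++ c1), c2.
have -> : (w ++ c1) ++ s ++ c2 = w ++ (c1 ++ s ++ c2) by rewrite -catA.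
by apply: comm => //; move: nc2; rewrite -!catA.
Qed.

(** Multiply a relation on the left by a factor [s] as long as the period: the
words that remain nonzero all start with [s], so they are prefixes of one
periodic sequence and have distinct lengths.  The longest one is then a
combination of shorter words.  It recurs in every long nonzero word, so the
algebra would be finite-dimensional. *)
Lemma periodic_indep c q : has_period c q -> nonzero_words = factors c ->
  forall n (al : n.-bseq 'I_d -> k), \sum_(w : n.-bseq 'I_d) al w *: wval w = 0 ->
  forall w : n.-bseq 'I_d, nonzero_words w -> al w = 0.
Proof.
move=> pc nzE n al E w0 nw0; apply/eqP/negPn/negP => al0.
have [p w0E] : factors c w0 by rewrite -nzE.
pose s := stretch c p q.
(* a nonzero word that starts with [s] is determined by its length *)
have sw (w : seq 'I_d) : nonzero_words (s ++ w) -> w = stretch c (p + q) (size w).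
  rewrite nzE => -[p' /stretch_cat_eq[sE wE]].
  rewrite size_stretch in sE wE.
  have cE m : c (p' + m)%N = c (p + m)%N.
    have q0 := pc.1; have mq : (m %% q < q)%N by rewrite ltn_pmod.
    have xx : 'I_d := c 0%N.
    rewrite (divn_eq m q) addnC [(p + _)%N]addnC -!addnA !(addnC (_ * q)%N) !(periodicM _ _ pc).
    rewrite addnC [(_ + p)%N]addnC.
    by rewrite -(nth_stretch xx c p' mq) -(nth_stretch xx c p mq) -sE.
  rewrite wE size_stretch; apply: (@eq_from_nth _ (c 0%N)); rewrite !size_stretch // => m mw.
  by rewrite !nth_stretch // -!addnA cE.
have Q0 : (al w0 != 0) && (wval (s ++ w0) != 0).
  rewrite al0 /=; change (nonzero_words (s ++ w0)); rewrite nzE; exists p; rewrite size_cat stretch_cat size_stretch.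
  congr (_ ++ _); rewrite {1}w0E -(stretch_shift 1 p _ pc) mul1n //.
case: (@arg_maxnP _ w0 (fun w : n.-bseq 'I_d => (al w != 0) && (wval (s ++ w) != 0)) (fun w : n.-bseq 'I_d => size w) Q0).
move=> w1 /andP[al1 nw1] wmax.
pose g := s ++ w1; pose m := size g.
have mE : m = (q + size w1)%N by rewrite /m size_cat size_stretch.
have q0 := pc.1.
have gm : wspan m.-1 (wval g).
  have sb := @wspan_subspace m.-1.
  have -> : wval g = (al w1)^-1 *: (al w1 *: wval g) by rewrite scalerA mulVf // scale1r.
  apply: (subspaceZ _ sb).
  have : wval s * (\sum_(w : n.-bseq 'I_d) al w *: wval w) = 0 by rewrite E mulr0.
  rewrite (bigD1 w1) //= mulrDr -scalerAr -wval_cat -/g => /eqP.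
  rewrite addr_eq0 => /eqP ->; apply: (subspaceN sb).
  rewrite mulr_sumr; apply: (subspace_sum _ sb) => w ww1.
  rewrite -scalerAr -wval_cat.
  have [->|alw] := eqVneq (al w) 0; first by rewrite scale0r; case: sb.
  have [->|nsw] := eqVneq (wval (s ++ w)) 0; first by rewrite scaler0; case: sb.
  apply: (subspaceZ _ sb); apply: wspan_wval; rewrite mE size_cat size_stretch.
  have le : (size w <= size w1)%N by apply: wmax; rewrite alw nsw.
  have : size w <> size w1.
    move=> es; move/eqP: ww1; apply; apply: val_inj => /=.
    by rewrite (sw _ nsw) (sw _ nw1) es.
  lia.
have small (x : seq 'I_d) : (m + q <= size x)%N -> wspan (size x).-1 (wval x).
  move=> xm; have [/eqP ->|nx] := boolP (wval x == 0); first by case: (wspan_subspace (size x).-1).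
  have [p' xE] : factors c x by rewrite -nzE.
  have [p1 gE] : factors c g by rewrite -nzE; exact: nw1.
  rewrite -/m in gE.
  have [p2 /andP[pp2 p2q]] := stretch_in_window p' p1 m pc.
  rewrite -gE => gE2.
  have : wval x = wval (stretch c p' (p2 - p')) * (wval g * wval (stretch c (p2 + m) (size x - m - (p2 - p')))).
    rewrite {1}xE -!wval_cat.
    have -> : size x = ((p2 - p') + (m + (size x - m - (p2 - p'))))%N by lia.
    rewrite !stretch_cat gE2; congr (wval (_ ++ _)).
    have -> : (p' + (p2 - p'))%N = p2 by lia.
    by congr (_ ++ stretch _ _ _); lia.
  move=> ->; have -> : ((size x).-1 = (p2 - p') + (m.-1 + (size x - m - (p2 - p'))))%N by lia.
  by apply: wspan_mul; [|apply: wspan_mul => //]; apply: wspan_wval; rewrite size_stretch.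
have all N : wspan N `<=` wspan (m + q)%N.
  elim: N => [|N IH]; first exact: wspan_mono.
  apply: lin_span_le => _ [x /= xN <-].
  have [xm|xm] := leqP (size x) (m + q)%N; first exact: wspan_wval.
  apply: IH; apply: wspan_mono (small x (ltnW xm)); lia.
have [N bN] := wspan_finite (m + q)%N.
apply: (@infinite_dim N); apply: dim_leS bN => // x _.
by have [N' /all] := gen x.
Qed.

End Prime.
End Generated.

(** * Frames and GK dimension *)

Section Frames.
Variables (k : fieldType) (d : nat) (A : algType k) (a : 'I_d -> A).
Hypothesis gen : forall x, exists n, wspan a n x.
Implicit Types (U : set A) (x y : A).

Lemma pow_vsubspace U n : vsubspace (pow_space U n).
Proof. exact: lin_span_subspace. Qed.

Lemma pow_prod U n (v : 'I_n -> A) : (forall i, U (v i)) -> pow_space U n (\prod_(i < n) v i).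
Proof. by move=> Uv; apply: sub_lin_span; exists v. Qed.

Lemma pow_mul U n m x y : pow_space U n x -> pow_space U m y -> pow_space U (n + m)%N (x * y).
Proof.
apply: lin_spanM => _ _ [v Uv <-] [v' Uv' <-].
have -> : \prod_i v i * \prod_i v' i =
    \prod_(i < (n + m)%N) (match fintype.split i with inl i => v i | inr i => v' i end).
  rewrite big_split_ord /=; congr (_ * _); apply: eq_bigr => i _.
    by rewrite (unsplitK (inl i : _ + _)%type).
  by rewrite (unsplitK (inr i : _ + _)%type).
by apply: pow_prod => i; case: fintype.split => j; [exact: Uv|exact: Uv'].
Qed.

Lemma pow_one U n : U 1 -> pow_space U n 1.
Proof.
move=> U1; have -> : 1 = \prod_(i < n) (1 : A) by rewrite big1.
exact: pow_prod.
Qed.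

Lemma pow_mono U n m : U 1 -> (n <= m)%N -> pow_space U n `<=` pow_space U m.
Proof.
move=> U1 nm x Ux; rewrite -[x]mulr1 -(subnKC nm).
by apply: pow_mul => //; apply: pow_one.
Qed.

Lemma sub_pow1 U : U `<=` pow_space U 1.
Proof.
move=> x Ux; have -> : x = \prod_(i < 1) x by rewrite big_ord1.
exact: pow_prod.
Qed.

Lemma alg_span_pow U : U 1 -> alg_span U `<=` \bigcup_n pow_space U n.
Proof.
move=> U1; apply: smallest_sub => [|x Ux]; last by exists 1%N => //; apply: sub_pow1.
split.
- by apply/mem_set; exists 0%N => //; apply: pow_one.
- move=> c x y /set_mem[n _ Ux] /set_mem[m _ Uy]; apply/mem_set; exists (maxn n m) => //.
  case: (pow_vsubspace U (maxn n m)) => _; apply.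
    by apply: pow_mono Ux; rewrite ?leq_maxl.
  by apply: pow_mono Uy; rewrite ?leq_maxr.
- move=> x y /set_mem[n _ Ux] /set_mem[m _ Uy]; apply/mem_set.
  by exists (n + m)%N => //; apply: pow_mul.
Qed.

Lemma frame_sub_wspan U : frame U -> exists c, U `<=` wspan a c.
Proof.
case=> -[n [b [_ bU]]] _ _.
have /choice[c cP] : forall i, exists c, wspan a c (b i) by move=> i; apply: gen.
exists (\max_i c i)%N; rewrite -bU; apply: lin_span_min; first exact: wspan_subspace.
by move=> _ [i _ <-]; apply: wspan_mono (cP i); apply: leq_bigmax.
Qed.

Lemma pow_sub_wspan U c n : U `<=` wspan a c -> pow_space U n `<=` wspan a (n * c)%N.
Proof.
move=> Uc; apply: lin_span_min; first exact: wspan_subspace.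
move=> _ [v Uv <-]; elim: n v Uv => [|n IH] v Uv; first by rewrite big_ord0; apply: wspan1.
rewrite big_ord_recl mulSn; apply: wspan_mul; first exact: Uc.
by apply: (IH (fun i => v (lift ord0 i))) => i; apply: Uv.
Qed.

Lemma wspan_sub_pow U : frame U -> exists c, forall n, wspan a n `<=` pow_space U (n * c)%N%N.
Proof.
case=> _ U1 UT.
have /choice[c cP] : forall i, exists c, pow_space U c (a i).
  by move=> i; have [|c _] := @alg_span_pow _ U1 (a i); [rewrite UT|exists c].
pose C := (\max_i c i)%N; exists C => n.
apply: lin_span_min; first exact: pow_vsubspace.
move=> _ [w /= wn <-]; apply: (pow_mono U1 (_ : size w * C <= n * C)%N).
  by rewrite leq_mul2r wn orbT.
elim: w {wn} => [|i w IH]; first by rewrite /wval big_nil; apply: pow_one.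
rewrite mulSn /wval big_cons; apply: pow_mul => //.
by apply: pow_mono (cP i) => //; apply: leq_bigmax.
Qed.

(** Powers of a frame are finite-dimensional, so [dimk] is their dimension and
not a default value. *)
Lemma pow_dim U n : frame U -> dim_le (pow_space U n) (dimk (pow_space U n)).
Proof.
move=> /frame_sub_wspan[c Uc]; have [N bN] := wspan_finite a (n * c)%N.
apply: (@dim_le_dimk _ _ _ N); first exact: pow_vsubspace.
by apply: dim_leS bN => //; apply: pow_sub_wspan.
Qed.

End Frames.

Section Growth.
Variables (R : realType).

(** Otherwise the limit superior would be at least [3/2]. *)
Lemma growth_lt (D : nat -> nat) :
  limn_esup (fun n : nat => (ln (D n)%:R / ln n%:R : R)%:E) = 1%:E ->
  exists M, forall n, (M <= n)%N -> (D n ^ 2 < n ^ 3)%N.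
Proof.
rewrite /limn_esup /limf_esup => E.
have : (ereal_inf [set ereal_sup [set (ln (D n)%:R / ln n%:R : R)%:E | n in V] | V in \oo] < (3%:R / 2%:R)%:E)%E.
  by rewrite E lte_fin ltr_pdivlMr // mul1r ltr_nat.
move=> /ereal_inf_lt[_ [V [M _ MV] <-] lt].
exists (maxn M 2) => n; rewrite geq_max => /andP[Mn n2].
have [->|D0] := posnP (D n); first by rewrite expn_gt0 (ltn_trans _ n2).
have n1 : 1 < n%:R :> R by rewrite ltr1n.
have lnn0 : 0 < ln (n%:R : R) by apply: ln_gt0.
have : (ln (D n)%:R / ln n%:R : R) < 3%:R / 2%:R.
  rewrite -lte_fin; apply: le_lt_trans lt.
  by apply: ereal_sup_ubound; exists n => //; apply: MV.
rewrite ltr_pdivrMr // mulrAC ltr_pdivlMr // mulr_natl mulr_natr.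
rewrite -!lnXn ?ltr0n ?(ltn_trans _ n2) //.
rewrite ltr_ln ?posrE ?exprn_gt0 ?ltr0n ?(ltn_trans _ n2) //.
by rewrite -!natrX ltr_nat.
Qed.

Lemma growth_bounded (D : nat -> nat) N : (forall n, (D n <= N)%N) ->
  limn_esup (fun n : nat => (ln (D n)%:R / ln n%:R : R)%:E) <> 1%:E.
Proof.
move=> DN E.
have : (limn_esup (fun n : nat => (ln (D n)%:R / ln n%:R : R)%:E) <= (2%:R^-1)%:E)%E.
  rewrite /limn_esup /limf_esup.
  apply: le_trans (ereal_inf_lbound _) _.
    (* from there on, [N] is at most the square root of [n] *)
    by exists [set n | (N.+2 ^ 2 <= n)%N] => //; apply: nbhs_infty_ge.
  apply: ge_ereal_sup => _ [n /= Nn <-].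
  have n2 : (1 < n)%N by apply: leq_trans Nn; rewrite -mulnn; nia.
  have lnn0 : 0 < ln (n%:R : R) by apply: ln_gt0; rewrite ltr1n.
  rewrite lee_fin ler_pdivrMr // mulrC ler_pdivlMr // mulr_natr.
  have [->|D0] := posnP (D n); first by rewrite ln0 // mul0rn ltW.
  rewrite -lnXn ?ltr0n // ler_ln ?posrE ?exprn_gt0 ?ltr0n ?(ltn_trans _ n2) //.
  rewrite -natrX ler_nat; apply: leq_trans Nn; rewrite leq_exp2r //.
  by apply: leq_trans (DN n) _; lia.
rewrite E lee_fin => h; have : (1 : R) < 1; last by rewrite ltxx.
by apply: le_lt_trans h _; rewrite invf_lt1 // ltr1n.
Qed.

Variables (k : fieldType) (d : nat) (A : algType k) (a : 'I_d -> A).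
Hypothesis gen : forall x, exists n, wspan a n x.

Lemma GKdim1_infinite : has_GKdim A (1%:E : \bar R) -> forall N, ~ dim_le (setT : set A) N.
Proof.
case=> U fU gU N AN; apply: (growth_bounded (N := N)) gU => n.
by apply: dimk_le; apply: dim_leS AN.
Qed.

Lemma GKdim1_small : has_GKdim A (1%:E : \bar R) ->
  exists n N, dim_le (wspan a n) N /\ (2 * N < n.+1 * n.+2)%N.
Proof.
case=> U fU /growth_lt[M MP]; have [c0 c0P] := wspan_sub_pow a fU.
(* [n] is large enough for [D ^ 2 < (n c) ^ 3 <= n ^ 4 / 4], so that [2 D < n ^ 2] *)
pose c := c0.+1; pose n := (M + 4 * c ^ 3)%N.
exists n, (dimk (pow_space U (n * c)%N)); split.
  apply: (dim_leS _ (leqnn _) (pow_dim (n := (n * c)%N) gen fU)) => x /c0P.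
  case: fU => _ U1 _; apply: pow_mono => //; rewrite leq_mul2l leqnSn orbT //.
have : (M <= n * c)%N by rewrite /n /c; nia.
move/MP; set D := dimk _ => DP.
have h : (4 * (n * c) ^ 3 <= (n ^ 2) ^ 2)%N.
  have : (4 * c ^ 3 <= n)%N by rewrite /n leq_addl.
  move/(leq_mul (leqnn (n ^ 3))); rewrite -expnM expnMn -expnSr; lia.
have : ((2 * D) ^ 2 < (n ^ 2) ^ 2)%N by rewrite expnMn; lia.
by rewrite ltn_exp2r // -mulnn; nia.
Qed.

Lemma quadratic_growth_not_linear K : quadratic_growth R A ->
  ~ (forall n, dim_le (wspan a n) (K * n.+1)%N).
Proof.
case=> U fU [C1 [C2 [C10 _ CP]]] bK.
have [c Uc] := frame_sub_wspan gen fU.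
have DP n : (dimk (pow_space U n) <= K * (n * c).+1)%N.
  by apply: dimk_le; apply: dim_leS (bK (n * c)%N) => //; apply: pow_sub_wspan.
pose n := (Num.truncn ((K * c.+1)%:R / C1 : R)).+1.
have nP : (K * c.+1)%:R / C1 < n%:R :> R by apply: truncnS_gt.
have /andP[h _] := CP n isT.
have : C1 * n%:R ^+ 2 <= (K * c.+1 * n)%:R.
  apply: le_trans h _; rewrite ler_nat; apply: leq_trans (DP n) _.
  by rewrite /n; nia.
rewrite natrM expr2 mulrA ler_pM2r ?ltr0n // leNgt; apply/negP; rewrite negbK.
by rewrite mulrC -ltr_pdivrMr.
Qed.

End Growth.

(** * Quotients, free algebras and counting *)

Section Quotients.
Variables (k : fieldType) (d : nat) (A : algType k) (a : 'I_d -> A) (P : properIdeal A).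

Definition quot_letter i : quot_alg P := quot_pi P (a i).

Lemma quot_pi_sum (T : Type) (r : seq T) (F : T -> A) :
  quot_pi P (\sum_(i <- r) F i) = \sum_(i <- r) quot_pi P (F i).
Proof. by apply: (big_morph (quot_pi P)); [exact: quot_piD|exact: quot_pi0]. Qed.

Lemma quot_pi_wval w : quot_pi P (wval a w) = wval quot_letter w.
Proof. by apply: (big_morph (quot_pi P)); [exact: quot_piM|]. Qed.

Lemma quot_pi_eq0 x : quot_pi P x = 0 <-> ideal_set P x.
Proof. by rewrite -[x in ideal_set P x]subr0 -quot_piE quot_pi0. Qed.

Lemma quot_pi_comb n (c : n.-bseq 'I_d -> k) :
  quot_pi P (\sum_(w : n.-bseq 'I_d) c w *: wval a w) =
  \sum_(w : n.-bseq 'I_d) c w *: wval quot_letter w.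
Proof.
by rewrite quot_pi_sum; apply: eq_bigr => w _; rewrite -quot_pi_wval; apply: quot_piZ.
Qed.

Lemma quot_gen : (forall x, exists n, wspan a n x) -> forall x, exists n, wspan quot_letter n x.
Proof.
move=> gen x; have [n /wspan_bseq[c E]] := gen (quot_repr x).
exists n; apply/wspan_bseq; exists c.
by rewrite -quot_pi_comb -E quot_reprK.
Qed.

Lemma quot_nonzero_sub : nonzero_words quot_letter `<=` nonzero_words a.
Proof.
move=> w; rewrite /nonzero_words /= -quot_pi_wval; apply: contra_neq => ->.
exact: quot_pi0.
Qed.

End Quotients.

(** If [x A y] lies in [P], then so does the product [J K], where [J] consists
of the [u] with [u A y] in [P] and [K] of the [v] with [J A v] in [P]. *)
Lemma prime_ideal_mul (A : nzRingType) (P : set A) x y : prime_ideal P ->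
  ~ P x -> ~ P y -> exists z, ~ P (x * z * y).
Proof.
case=> -[[P0 PB] PM] _ prP Px Py; apply: contrapT => h.
have PB' u v : P u -> P v -> P (u - v).
  by move=> /mem_set Pu /mem_set Pv; apply/set_mem/PB.
pose J := [set u | forall z, P (u * z * y)].
pose K := [set v | forall u z, J u -> P (u * z * v)].
have JI : two_sided_ideal J.
  split; first split.
  - by apply/mem_set => z; rewrite !mul0r; apply: set_mem.
  - move=> u v /set_mem Ju /set_mem Jv; apply/mem_set => z.
    by rewrite !mulrBl; apply: PB'.
  - move=> b c u Ju z; have := PM b 1 _ (Ju (c * z)); by rewrite mulr1 !mulrA.
have KI : two_sided_ideal K.
  split; first split.
  - by apply/mem_set => u z _; rewrite mulr0; apply: set_mem.
  - move=> u v /set_mem Ku /set_mem Kv; apply/mem_set => t z Jt.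
    by rewrite mulrBr; apply: PB'; [apply: Ku|apply: Kv].
  - move=> b c v Kv u z Ju; have := PM 1 c _ (Kv u (z * b) Ju).
    by rewrite mul1r !mulrA.
have [] := prP J K JI KI.
- by move=> u v Ju Kv; rewrite -[u]mulr1; apply: Kv.
- move=> JP; apply/Px/JP => z; apply: contrapT => hz; apply: h; by exists z.
- by move=> KP; apply/Py/KP => u z; apply.
Qed.

Lemma quot_prime (k : fieldType) (A : algType k) (P : properIdeal A) :
  prime_ideal P -> forall x y : quot_alg P, x != 0 -> y != 0 -> exists z, x * z * y != 0.
Proof.
move=> prP x y; rewrite -[x]quot_reprK -[y]quot_reprK => x0 y0.
have [||z hz] := prime_ideal_mul (x := quot_repr x) (y := quot_repr y) prP.
- by move/quot_pi_eq0 => h; rewrite h eqxx in x0.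
- by move/quot_pi_eq0 => h; rewrite h eqxx in y0.
exists (quot_pi P z); apply/eqP => h; apply: hz; apply/quot_pi_eq0; rewrite -[RHS]h.
by rewrite quot_piM quot_piM.
Qed.

Lemma free_alg_gen (k : fieldType) (d : nat) (x : free_alg k d) :
  exists n, wspan (@letter k d) n x.
Proof.
have wordE (w : seq 'I_d) : mkmalgU (FMonom w) 1 = wval (@letter k d) w.
  elim: w => [|i w IH]; first by rewrite /wval big_nil -fmoneE.
  rewrite /wval big_cons -/(wval _ _) -IH; apply/esym.
  have -> : FMonom (i :: w) = mmul (fmu i) (FMonom w).
    by rewrite -[mmul _ _]/(fmmul _ _) fmmulE fmuE.
  transitivity (mkmalgU (mmul (fmu i) (FMonom w)) ((1 : k) * 1)); first exact: fgmulUU.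
  by rewrite mulr1.
have UZ (m : fmonom 'I_d) (c : k) : mkmalgU m c = c *: (mkmalgU m 1 : free_alg k d).
  by apply/(@malgP _ k) => m'; rewrite mcoeffZ !mcoeffU mulrnAr mulr1.
exists (\max_(m <- finmap.enum_fset (msupp x)) size (fmonom_val m))%N.
rewrite [x in wspan _ _ x]monalgE [X in wspan _ _ X]big_seq.
apply: (subspace_sum _ (wspan_subspace _ _)) => m mx.
rewrite UZ; apply: (subspaceZ _ (wspan_subspace _ _)).
case: m mx => w mx; rewrite wordE; apply: wspan_wval.
exact: (leq_bigmax_seq (FMonom w) mx isT).
Qed.

Lemma card_le_inj T (S : set T) m : `I_m #<= S ->
  exists2 f : 'I_m -> T, injective f & forall i, S (f i).
Proof.
move=> mS; have : [set: 'I_m] #<= S.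
  by apply: card_le_trans mS; move: (@card_II m); rewrite card_eq_sym card_eq_le => /andP[].
move=> /card_leP[f].
pose g (i : 'I_m) := f (SigSub (mem_set (I : [set: 'I_m] i))).
exists (fun i => val (g i)); last by move=> i; apply: set_valP.
move=> i j /val_inj E.
have := @inj _ _ _ f _ _ (mem_set I) (mem_set I) E.
by move/(congr1 val).
Qed.

Section Counting.
Variables (k : fieldType) (d : nat) (A : algType k) (a : 'I_d -> A).

Lemma wspan_dim_nonzero n : dim_le (wspan a n) (count_upto (nonzero_words a) n).
Proof.
pose S := {w : n.-bseq 'I_d | `[< nonzero_words a w >]}.
have -> : count_upto (nonzero_words a) n = #|{: S}| by rewrite card_sig.
apply: (@dim_le_span _ _ _ (wval a \o (fun w : S => val w : seq 'I_d))).
apply: lin_span_le => _ [w /= wn <-].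
have [/eqP ->|nw] := boolP (wval a w == 0).
  by case: (lin_span_subspace (range (wval a \o (fun w : S => val w : seq 'I_d)))).
by apply: sub_lin_span; exists (exist _ (Bseq wn) (asboolT nw)).
Qed.

End Counting.

Lemma count_len_factors (T : finType) (c : nat -> T) q n :
  has_period c q -> (count_len (factors c) n <= q)%N.
Proof.
move=> pc.
have /choice[p pP] : forall t : n.-tuple T, exists p : 'I_q,
    factors c t -> val t = stretch c p n.
  move=> t; have [[i tE]|nt] := pselect (factors c t); last by exists (Ordinal pc.1).
  have [p /andP[_ pq] pE] := stretch_in_window 0 i n pc.
  by exists (Ordinal pq) => _; rewrite /= tE size_tuple.
rewrite -[q in (_ <= q)%N]card_ord; apply: (@count_len_le _ _ _ _ p) => t t' ct ct' E.
by apply: val_inj; rewrite /= (pP _ ct) (pP _ ct') E.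
Qed.

Lemma sum_excess n N : ((n - N) ^ 2 <= 2 * \sum_(i < n.+1) (i - N))%N.
Proof.
elim: n => [|n IH]; first by rewrite sub0n.
rewrite big_ord_recr /= mulnDr; have [le|lt] := leqP n.+1 N.
  by rewrite (eqP (le : (n.+1 - N == 0)%N)).
have -> : (n.+1 - N = (n - N).+1)%N by lia.
apply: leq_trans (leq_add IH (leqnn _)).
by move: (n - N)%N => x; rewrite -!mulnn; nia.
Qed.

(** Divide by [n^2] and let [n] tend to infinity. *)
Lemma quadratic_compare (R : realType) (C : R) m N N0 :
  (forall n, (N0 <= n)%N -> (m * (n - N) ^ 2)%:R <= 2 * C * n%:R ^+ 2) ->
  m%:R <= 2 * C.
Proof.
move=> h; rewrite leNgt; apply/negP => lt.
pose e := m%:R - 2 * C; have e0 : 0 < e by rewrite subr_gt0.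
pose n := (N0 + N + (Num.truncn ((2 * m * N)%:R / e : R)).+1)%N.
have nN : (N <= n)%N by rewrite /n; lia.
have := h n; rewrite natrM natrX natrB // => /(_ _)/wrap[|{}h].
  by rewrite /n; lia.
have n0 : 0 < n%:R :> R by rewrite ltr0n /n; lia.
have : (2 * m * N)%:R < n%:R * e.
  rewrite -ltr_pdivrMr //; apply: lt_le_trans (truncnS_gt _) _.
  by rewrite ler_nat leq_addl.
rewrite !natrM /e => h2.
have m0 : 0 <= m%:R :> R by rewrite ler0n.
have NN : 0 <= N%:R :> R by rewrite ler0n.
have := mulr_ge0 m0 (mulr_ge0 NN NN).
have : 0 < n%:R * (n%:R * (m%:R - 2 * C) - 2 * m%:R * N%:R) by rewrite mulr_gt0 // subr_gt0.
rewrite !expr2 in h *; nra.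
Qed.

(** * Primes of GK dimension one *)

Section GKdimOne.
Variables (R : realType) (k : fieldType) (d : nat) (A : algType k) (a : 'I_d -> A).
Hypothesis gen : forall x, exists n, wspan a n x.
Variable M : nat.
Hypothesis cM : forall n, (count_len (nonzero_words a) n <= M * n.+1 ^ 2)%N.
Implicit Types P : properIdeal A.

Definition GK1_prime P := prime_ideal P /\ has_GKdim (quot_alg P) (1%:E : \bar R).

(** The nonzero words of [A/P] are among those of [A], so there are polynomially
many of them. *)
Lemma GK1_periodic P : GK1_prime P ->
  exists c q, has_period (c : nat -> 'I_d) q /\ nonzero_words (quot_letter a P) = factors c.
Proof.
case=> prP gk; have genP := quot_gen (P := P) gen; have primeP := quot_prime prP.
have infP := GKdim1_infinite gk.
have [n [N [bN Nn]]] := GKdim1_small genP gk.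
have [x0 _] := exists_nonzero_letter genP infP.
have [K bK] := linear_growth x0 bN Nn.
apply: (nonzero_words_periodic genP primeP infP bK) => n'; apply: leq_trans (cM n').
rewrite /count_len; apply/subset_leq_card/fintype.subsetP => t; rewrite !inE.
exact: quot_nonzero_sub.
Qed.

(** The nonzero words of [A/P] are independent, so an element of [P] is a
combination of words in [P], and these are the words in [P']. *)
Lemma GK1_sub P P' : GK1_prime P -> nonzero_words (quot_letter a P) = nonzero_words (quot_letter a P') ->
  P `<=` P'.
Proof.
move=> P1 E x /quot_pi_eq0 Px; apply/quot_pi_eq0.
have [c [q [pc nzE]]] := GK1_periodic P1.
have [n /wspan_bseq[al xE]] := gen x.
have := Px; rewrite xE !quot_pi_comb => Px0.
have al0 := periodic_indep (quot_gen (P := P) gen) (GKdim1_infinite P1.2) pc nzE Px0.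
rewrite big1 // => w _; have [/eqP ->|nw] := boolP (wval (quot_letter a P') w == 0).
  by rewrite scaler0.
by rewrite al0 ?scale0r // E.
Qed.

Lemma GK1_inj P P' : GK1_prime P -> GK1_prime P' ->
  nonzero_words (quot_letter a P) = nonzero_words (quot_letter a P') -> P = P'.
Proof.
move=> P1 P1' E; have : ideal_set P = ideal_set P'.
  by apply/seteqP; split; [apply: GK1_sub|apply: GK1_sub].
case: P P' {P1 P1' E} => [J JI J1] [J' J'I J'1] /= JJ'; subst J'.
by rewrite (Prop_irrelevance JI J'I) (Prop_irrelevance J1 J'1).
Qed.

End GKdimOne.

Lemma count_len_polynomial (R : realType) (T : finType) (L : set (seq T)) (C : R) :
  0 < C -> (\forall n \near \oo, (count_upto L n)%:R <= C * n%:R ^+ 2) ->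
  exists M, forall n, (count_len L n <= M * n.+1 ^ 2)%N.
Proof.
move=> C0 [N _ NP]; pose c := (Num.truncn C).+1.
exists (c + #|T|.+1 ^ N)%N => n; have [nN|nN] := leqP N n.
  apply: (@leq_trans (count_upto L n)); first by rewrite count_uptoE big_ord_recr leq_addl.
  rewrite -(ler_nat R); apply: le_trans (NP n nN) _.
  rewrite natrM natrX; apply: ler_pM; [exact: ltW|exact: exprn_ge0| |].
    by apply: le_trans (ltW (truncnS_gt C)) _; rewrite ler_nat leq_addr.
  by rewrite lerXn2r ?nnegrE // ler_nat.
apply: leq_trans (count_len_max _ _) _; apply: (@leq_trans (#|T|.+1 ^ n)).
  by case: (n) => [|n'] //; rewrite leq_exp2r.
apply: (@leq_trans (#|T|.+1 ^ N)); first by rewrite leq_pexp2l // ltnW.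
by apply: (@leq_trans (c + #|T|.+1 ^ N)%N); rewrite ?leq_addl // leq_pmulr.
Qed.

Theorem mainTheorem2 (R : realType) (k : fieldType) (d : nat)
    (I : properIdeal (free_alg k d)) (W : set (seq 'I_d)) (C : R) :
  ideal_set I = ideal_generated [set word k w | w in W] ->
  prime_ring (quot_alg I) ->
  quadratic_growth R (quot_alg I) ->
  0 < C ->
  (\forall n \near \oo,
     #|[pred w : n.-bseq 'I_d | quot_pi I (word k w) != 0]|%:R
       <= C * n%:R ^+ 2) ->
  exists m : nat,
    [set P : properIdeal (quot_alg I) |
       prime_ideal P /\ has_GKdim (quot_alg P) (1%:E : \bar R)]
      #= `I_m
    /\ m%:R <= 2 * C.
Proof.
move=> _ prA qA C0 hC.
pose a := quot_letter (@letter k d) I.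
have gen : forall x, exists n, wspan a n x by apply/quot_gen/free_alg_gen.
have {}hC : \forall n \near \oo, (count_upto (nonzero_words a) n)%:R <= C * n%:R ^+ 2.
  apply: filterS hC => n; rewrite (_ : #|_| = count_upto (nonzero_words a) n) //.
  apply: eq_card => w; rewrite !inE /=.
  by rewrite (quot_pi_wval (@letter k d) I w) /nonzero_words /=; apply/idP/asboolP.
have [M cM] := count_len_polynomial C0 hC.
have primeA (x y : quot_alg I) : x != 0 -> y != 0 -> exists z, x * z * y != 0.
  move=> /eqP x0 /eqP y0; have [z hz] := prime_ideal_mul prA x0 y0.
  by exists z; apply/eqP.
have irr := nonzero_words_irreducible gen primeA.
have not_periodic (c : nat -> 'I_d) q : has_period c q -> factors c <> nonzero_words a.
  move=> pc E; apply: (quadratic_growth_not_linear gen (K := q) qA) => n.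
  apply: dim_leS (@wspan_dim_nonzero _ _ _ a n) => //.
  rewrite count_uptoE -E; apply: (@leq_trans (\sum_(i < n.+1) q)).
    by apply: leq_sum => i _; apply: count_len_factors.
  by rewrite sum_nat_const card_ord mulnC.
set S := [set P | _].
have bound m : `I_m #<= S -> m%:R <= 2 * C.
  move=> /card_le_inj[f fi fS].
  have /choice[c cP] i : exists c : nat -> 'I_d, exists q,
      has_period c q /\ nonzero_words (quot_letter a (f i)) = factors c.
    by have [c [q cq]] := GK1_periodic gen cM (fS i); exists c, q.
  have /choice[q cq] := cP.
  have [N NP] := exit_count (nonzero_words_closed (a := a)) irr (fun i => (cq i).1)
    (fun i => eq_ind _ (fun F => F `<=` nonzero_words a) (@quot_nonzero_sub _ _ _ a (f i)) _ (cq i).2)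
    (fun i => not_periodic _ _ (cq i).1)
    (fun i j ij e => negP ij (introT eqP (fi i j (GK1_inj gen cM (fS i) (fS j)
      (etrans (cq i).2 (etrans e (esym (cq j).2))))))).
  case: hC => N0 _ N0P; apply: (@quadratic_compare _ _ _ N N0) => n nN.
  apply: (@le_trans _ _ (2 * (count_upto (nonzero_words a) n)%:R)); last first.
    by rewrite -mulrA ler_pM2l // N0P.
  rewrite -natrM ler_nat count_uptoE.
  apply: (@leq_trans (m * (2 * \sum_(i < n.+1) (i - N)))).
    by rewrite leq_mul2l sum_excess orbT.
  rewrite mulnCA leq_mul2l big_distrr /=.
  by apply: leq_sum => i _; apply: NP.
have [/finite_setP[m Sm]|/infiniteP Sinf] := pselect (finite_set S).
  exists m; split=> //; apply: bound.
  by move: Sm; rewrite card_eq_sym card_eq_le => /andP[].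
exfalso; pose m := (Num.truncn (2 * C)).+1.
have : m%:R <= 2 * C.
  by apply: bound; apply: card_le_trans Sinf; apply: subset_card_le.
by rewrite leNgt truncnS_gt.
Qed.
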